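(* Let $(X,Y)$ take values in $\mathbb R^d\times\{1,\dots,M\}$, let $\mu$ be the distribution of $X$ and $P_j(x)=\mathbb P\{Y=j\mid X=x\}$. Assume: (i) (strong density condition) $\mu$ has a density $f$ with respect to Lebesgue measure, and there are $\kappa>0$, $\gamma_0>0$, $\nu_0>0$ such that $\mu(B_\gamma(x))\ge \kappa f(x)\gamma^d$ for all $x\in\mathbb R^d$ and all $0<\gamma\le\gamma_0$, and $f(x)\ge \nu_0$ for all $x$ in the support of $\mu$; (ii) (Tsybakov margin condition) there are $\alpha>0$ and $c^*>0$ such that $\mathbb P\{\eta(X)\le t\}\le c^*t^\alpha$ for all $0<t\le 1$; (iii) (Hölder condition) there are $C>0$ and $0<\beta\le 1$ such that $|P_j(x)-P_j(x')|\le C\|x-x'\|_2^\beta$ for all $x,x'\in\mathbb R^d$ and all $j\in\{1,\dots,M\}$. Let $g^{\mathrm{OptiNet}}_{n,m,\gamma}$ be the OptiNet classifier built from $n$ labeled samples and $m$ unlabeled samples with margin $\gamma$. Then there are constants $C_1,C_2,c>0$, not depending on $n$, $m$ or $\gamma$ (they may depend on $d$, $M$ and the parameters appearing in (i)–(iii)), such that for all $n,m\ge 1$ and all $0<\gamma\le\gamma_0$, $$\mathbb E\{L(g^{\mathrm{OptiNet}}_{n,m,\gamma})\}-L^*\le C_1 (n\gamma^d)^{-\frac{1+\alpha}{2}}+C_2\gamma^{\beta(1+\alpha)}+\exp(-c\,m\gamma^d).$$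
   Context: $\mathbb R^d$ is equipped with the Euclidean metric $\rho(x,y)=\|x-y\|_2$; $B_r(x)=\{x':\rho(x,x')<r\}$. The support of $\mu$ is $\{x:\mu(B_r(x))>0\ \forall r>0\}$. For a measurable $g:\mathbb R^d\to\{1,\dots,M\}$, $L(g)=\mathbb P\{g(X)\ne Y\}$ is its error probability (for a data-dependent $g$, the probability is conditional on the data, with $(X,Y)$ independent of the data). $L^*=\mathbb P\{g^*(X)\neq Y\}$ with $g^*(x)=\arg\max_j P_j(x)$ is the Bayes error. Let $P_{(1)}(x)\ge\dots\ge P_{(M)}(x)$ be the ordered values of $P_1(x),\dots,P_M(x)$ and $\eta(x)=P_{(1)}(x)-P_{(2)}(x)$. OptiNet. The data are $n$ i.i.d. copies $\mathcal D_n=((X_1,Y_1),\dots,(X_n,Y_n))$ of $(X,Y)$ and, in addition and independently, $m$ i.i.d. unlabeled copies $\mathbf X'_m=\{X'_1,\dots,X'_m\}$ of $X$. A $\gamma$-net of a set is any maximal subset in which all interpoint distances are at least $\gamma$. OptiNet takes a $\gamma$-net $\mathbf X(\gamma)=\{X_1(\gamma),\dots,X_{m(\gamma)}(\gamma)\}\subseteq\mathbf X'_m$ of $\mathbf X'_m$ (selected as a function of $\mathbf X'_m$). Let $V_\ell(\gamma)$ be the Voronoi cell of $X_\ell(\gamma)$, i.e. the set of $x\in\mathbb R^d$ whose nearest neighbor in $\mathbf X(\gamma)$ is $X_\ell(\gamma)$ (ties broken towards the smaller index in $\mathbf X'_m$). Each $X_\ell(\gamma)$ is paired with the label $Y_\ell(\gamma)=\arg\max_{j}\sum_{i=1}^n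 \mathbb I\{Y_i=j,\ X_i\in V_\ell(\gamma)\}$ (ties broken by a fixed rule). The classifier is $g^{\mathrm{OptiNet}}_{n,m,\gamma}(x)=Y_\ell(\gamma)$ for $x\in V_\ell(\gamma)$. *)

(* Defs.v *)
From HB Require Import structures.
From mathcomp Require Import all_boot all_order all_algebra.
From mathcomp Require Import all_classical all_reals all_analysis.

Set Implicit Arguments.
Unset Strict Implicit.
Unset Printing Implicit Defensive.

Import Order.TTheory GRing.Theory Num.Theory.
Import numFieldNormedType.Exports.

Local Open Scope classical_set_scope.
Local Open Scope ring_scope.

(* Class labels carry the discrete sigma-algebra; measurable types have to be
   pointed, hence 'I_k.+1. *)
HB.instance Definition _ k := isPointed.Build 'I_k.+1 ord0.
HB.instance Definition _ k := @isMeasurable.Build default_measure_display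
  'I_k.+1 discrete_measurable discrete_measurable0
  discrete_measurableC discrete_measurableU.

(* Points of R^d are d-tuples, whose library sigma-algebra, generated by the
   coordinates, is the Borel one. *)
Section euclidean.
Context {R : realType} {d : nat}.
Implicit Types x y : d.-tuple R.

Definition edist x y : R :=
  Num.sqrt (\sum_(i < d) (tnth x i - tnth y i) ^+ 2).

Definition eball x (r : R) : set (d.-tuple R) := [set y | edist x y < r].

Definition msupport (mu : set (d.-tuple R) -> \bar R) : set (d.-tuple R) :=
  [set x | forall r, 0 < r -> (0 < mu (eball x r))%E].

End euclidean.

Section lebesgue_tuple.
Context {R : realType}.

Section step.
Variable n : nat.

Definition tcons (x : R * n.-tuple R) : n.+1.-tuple R :=
  [the n.+1.-tuple R of x.1 :: x.2].

Lemma measurable_tcons : measurable_fun [set: R * n.-tuple R] tcons.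
Proof. by apply: measurable_cons. Qed.

Variable m : {sigma_finite_measure set (n.-tuple R) -> \bar R}.

Definition lebesgue_tcons : set (n.+1.-tuple R) -> \bar R :=
  pushforward (lebesgue_measure \x m)%E tcons.

Let mtcons (A : set (n.+1.-tuple R)) :
  measurable A -> measurable (tcons @^-1` A).
Proof. by move=> mA; rewrite -[X in measurable X]setTI; exact: measurable_tcons. Qed.

Let lebesgue_tcons0 : lebesgue_tcons set0 = 0%E.
Proof. by rewrite /lebesgue_tcons /pushforward preimage_set0 measure0. Qed.

Let lebesgue_tcons_ge0 A : (0 <= lebesgue_tcons A)%E.
Proof. by rewrite /lebesgue_tcons /pushforward; exact: measure_ge0. Qed.

Let lebesgue_tcons_sigma_additive : semi_sigma_additive lebesgue_tcons.
Proof.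
move=> F mF tF mUF; rewrite /lebesgue_tcons /pushforward preimage_bigcup.
apply: measure_semi_sigma_additive.
- by move=> i; exact: mtcons.
- apply/trivIsetP => /= i j _ _ ij; rewrite -preimage_setI.
  by move/trivIsetP : tF => /(_ _ _ _ _ ij) ->//; rewrite preimage_set0.
- by rewrite -preimage_bigcup; exact: mtcons.
Qed.

HB.instance Definition _ := isMeasure.Build _ _ _ lebesgue_tcons
  lebesgue_tcons0 lebesgue_tcons_ge0 lebesgue_tcons_sigma_additive.

Let tuncons (t : n.+1.-tuple R) : R * n.-tuple R := (thead t, [tuple of behead t]).

Let measurable_tuncons : measurable_fun setT tuncons.
Proof.
apply/measurable_fun_pairP; split.
  exact: (@measurable_tnth _ R n.+1 ord0).
exact: measurable_behead.
Qed.

Let tunconsK : cancel tuncons tcons.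
Proof. by move=> t; rewrite /tcons [RHS]tuple_eta; exact/val_inj. Qed.

Let tconsK : cancel tcons tuncons.
Proof. by move=> [a t]; congr pair; exact/val_inj. Qed.

Let lebesgue_tcons_sigma_finite : sigma_finite setT lebesgue_tcons.
Proof.
have /sigma_finiteP[F [FT ndF mF]] := sigma_finiteT (@lebesgue_measure R).
have /sigma_finiteP[G [GT ndG mG]] := sigma_finiteT m.
exists (fun i => tuncons @^-1` (F i `*` G i)).
  rewrite -preimage_bigcup (_ : \bigcup_i _ = setT) ?preimage_setT//.
  rewrite -subTset => -[x y] _.
  have [k _ Fkx] : (\bigcup_i F i) x by rewrite -FT.
  have [l _ Gly] : (\bigcup_i G i) y by rewrite -GT.
  exists (maxn k l) => //; split.
  - by move: x Fkx; exact/subsetPset/ndF/leq_maxl.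
  - by move: y Gly; exact/subsetPset/ndG/leq_maxr.
move=> i; have [mFi Fioo] := mF i; have [mGi Gioo] := mG i; split.
  rewrite -[X in measurable X]setTI; apply: measurable_tuncons => //.
  exact: measurableX.
rewrite /lebesgue_tcons /pushforward -comp_preimage.
rewrite (_ : tuncons \o tcons = id); last by apply/funext => x /=; rewrite tconsK.
by rewrite product_measure1E// lte_mul_pinfty// ge0_fin_numE.
Qed.

HB.instance Definition _ := Measure_isSigmaFinite.Build _ _ _ lebesgue_tcons
  lebesgue_tcons_sigma_finite.

End step.

(* d-fold product of the Lebesgue measure of the line, transported to tuples. *)
Fixpoint lebesgue_tuple (d : nat) :
    {sigma_finite_measure set (d.-tuple R) -> \bar R} :=
  if d is d'.+1 then lebesgue_tcons (lebesgue_tuple d')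
  else dirac [tuple].

Let tnth_lift0 d (a : d.+1.-tuple R) i :
  tnth a (lift ord0 i) = tnth [tuple of behead a] i.
Proof. by rewrite [in LHS](tuple_eta a) tnthS. Qed.

Lemma lebesgue_tuple_box (d : nat) (a b : d.-tuple R) :
  (forall i, tnth a i <= tnth b i) ->
  lebesgue_tuple d
    [set x | forall i, tnth x i \in `[tnth a i, tnth b i]] =
  (\prod_(i < d) (tnth b i - tnth a i))%:E.
Proof.
elim: d a b => [|d IH] a b ab /=.
  by rewrite big_ord0 diracE mem_set// => -[].
set a' := [tuple of behead a]; set b' := [tuple of behead b].
set B := [set t : d.-tuple R | forall i, tnth t i \in `[tnth a' i, tnth b' i]].
have mB : measurable B.
  rewrite (_ : B = \big[setI/setT]_(i < d)
      ((@tnth d R)^~ i @^-1` `[tnth a' i, tnth b' i])).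
    apply: bigsetI_measurable => i _; rewrite -[X in measurable X]setTI.
    exact: measurable_tnth.
  by rewrite -bigcap_seq; apply/seteqP; split => [t Bt i _|t Bt i];
    [exact: Bt|apply: Bt; rewrite /= mem_index_enum].
have a'b' i : tnth a' i <= tnth b' i by rewrite -!tnth_lift0.
transitivity ((lebesgue_measure \x lebesgue_tuple d)%E
    (`[tnth a ord0, tnth b ord0] `*` B)).
  congr (product_measure1 _ _ _); apply/seteqP; split => -[u t] /=.
    move=> H; split=> [|i]; first exact: (H ord0).
    by have := H (lift ord0 i); rewrite !tnth_lift0 -tnth_lift0 tnthS.
  move=> [H0 H] i; case: (unliftP ord0 i) => [j ->|->]; last exact: H0.
  by rewrite tnthS !tnth_lift0; exact: H.
rewrite product_measure1E// [X in (_ * X)%E]IH//.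
rewrite big_ord_recl EFinM; congr (_ * _)%E.
  rewrite [LHS]lebesgue_measure_itv/= lte_fin -EFinB; case: ltP => // ba.
  by rewrite (@le_anti _ _ (tnth b ord0) (tnth a ord0)) ?subrr// ba ab.
by congr EFin; apply: eq_bigr => i _; rewrite !tnth_lift0.
Qed.

End lebesgue_tuple.

Section probability_model.
Context {R : realType} {disp : measure_display} {Omega : measurableType disp}.
Variable P : probability Omega R.

Definition same_law d (T : measurableType d) (Z Z' : Omega -> T) : Prop :=
  forall A, measurable A -> P (Z @^-1` A) = P (Z' @^-1` A).

Definition mutually_independent (I : finType)
    (F : I -> set_system Omega) : Prop :=
  forall (J : {set I}) (E : I -> set Omega), (forall i, F i (E i)) ->
    P (\big[setI/setT]_(i in J) E i) = (\prod_(i in J) P (E i))%E.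

Context {d k : nat}.
Variables (X : {RV P >-> d.-tuple R}) (Y : {RV P >-> 'I_k.+2}).

(* p j is a version of x |-> P(Y = j | X = x). *)
Definition regression (p : 'I_k.+2 -> d.-tuple R -> R) : Prop :=
  forall j, measurable_fun setT (p j) /\
    forall A, measurable A ->
      P (X @^-1` A `&` Y @^-1` [set j]) =
      (\int[distribution P X]_(x in A) (p j x)%:E)%E.

Definition error (g : d.-tuple R -> 'I_k.+2) : R :=
  fine (P [set w | g (X w) != Y w]).

Definition bayes_rule (p : 'I_k.+2 -> d.-tuple R -> R) (x : d.-tuple R) :
    'I_k.+2 :=
  [arg max_(j > ord0) p j x]%O.

(* P_(1)(x) - P_(2)(x) *)
Definition eta (p : 'I_k.+2 -> d.-tuple R -> R) (x : d.-tuple R) : R :=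
  let s := sort (fun a b : R => b <= a) [seq p j x | j <- enum 'I_k.+2] in
  nth 0 s 0 - nth 0 s 1.

Definition strong_density (f : d.-tuple R -> R) (kappa gamma0 nu0 : R) : Prop :=
  let mu := distribution P X in
  [/\ measurable_fun setT f, forall x, 0 <= f x,
      forall A, measurable A ->
        mu A = (\int[lebesgue_tuple d]_(x in A) (f x)%:E)%E,
      forall x gamma, 0 < gamma <= gamma0 ->
        ((kappa * f x * gamma ^+ d)%:E <= mu (eball x gamma))%E &
      forall x, msupport mu x -> nu0 <= f x].

Definition tsybakov_margin (p : 'I_k.+2 -> d.-tuple R -> R)
    (alpha cstar : R) : Prop :=
  forall t, 0 < t <= 1 ->
    (P [set w | (eta p (X w) <= t)%R] <= (cstar * t `^ alpha)%:E)%E.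

Definition hoelder_condition (p : 'I_k.+2 -> d.-tuple R -> R)
    (C beta : R) : Prop :=
  forall j x x', `|p j x - p j x'| <= C * edist x x' `^ beta.

(* (Xs i, Ys i), i < n, are copies of (X, Y), the Xu j, j < m, are copies of X,
   and all these and (X, Y) are mutually independent; (X, Y) has index None. *)
Definition optinet_samples (n m : nat) (Xs : 'I_n -> {RV P >-> d.-tuple R})
    (Ys : 'I_n -> {RV P >-> 'I_k.+2}) (Xu : 'I_m -> {RV P >-> d.-tuple R}) :
    Prop :=
  [/\ forall i, same_law (fun w => (Xs i w, Ys i w)) (fun w => (X w, Y w)),
      forall j, same_law (Xu j) X &
      mutually_independent (fun l : option ('I_n + 'I_m) =>
        match l with
        | None => g_sigma_algebra_preimage (fun w => (X w, Y w))
        | Some (inl i) => g_sigma_algebra_preimage (fun w => (Xs i w, Ys i w))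
        | Some (inr j) => g_sigma_algebra_preimage (Xu j)
        end)].

End probability_model.

Section optinet.
Context {R : realType} {d k n m : nat}.

(* A subset of the sample xu is represented by the set of its indices. *)
Definition gamma_separated (gamma : R) (xu : m.-tuple (d.-tuple R))
    (N : {set 'I_m}) : bool :=
  [forall i in N, forall j in N,
    (i != j) ==> (gamma <= edist (tnth xu i) (tnth xu j))].

Definition gamma_net (gamma : R) (xu : m.-tuple (d.-tuple R))
    (N : {set 'I_m}) : bool :=
  maxset (gamma_separated gamma xu) N.

(* A net has to depend measurably on the sample for the expected error to make
   sense. *)
Definition net_selection (gamma : R)
    (net : m.-tuple (d.-tuple R) -> {set 'I_m}) : Prop :=
  (forall xu, gamma_net gamma xu (net xu)) /\
  (forall N, measurable (net @^-1` [set N])).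

Definition tie_breaking (tau : {set 'I_k.+2} -> 'I_k.+2) : Prop :=
  forall A : {set 'I_k.+2}, A != finset.set0 -> tau A \in A.

Variables (xu : m.-tuple (d.-tuple R)) (N : {set 'I_m}).

(* Membership of x in the Voronoi cell of tnth xu l. *)
Definition voronoi (l : 'I_m) (x : d.-tuple R) : bool :=
  (l \in N) && [forall i in N,
    (edist x (tnth xu l) < edist x (tnth xu i)) ||
    (edist x (tnth xu l) == edist x (tnth xu i)) && (l <= i)%N].

Variables (tau : {set 'I_k.+2} -> 'I_k.+2).
Variables (xs : 'I_n -> d.-tuple R) (ys : 'I_n -> 'I_k.+2).

Definition votes (l : 'I_m) (j : 'I_k.+2) : nat :=
  \sum_(i < n) ((ys i == j) && voronoi l (xs i)).

Definition net_label (l : 'I_m) : 'I_k.+2 :=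
  tau [set j | [forall j', (votes l j' <= votes l j)%N]]%SET.

(* When N is nonempty the cells partition the space and the default ord0 is not
   used. *)
Definition optinet (x : d.-tuple R) : 'I_k.+2 :=
  if [pick l | voronoi l x] is Some l then net_label l else ord0.

End optinet.

(* Main.v *)
(** The excess error of a classifier [g] is the integral of
    [Delta_g x = max_j p_j x - p_(g x) x].  Condition on the unlabeled sample and
    let [G] be the set of points at distance less than [gamma] of that sample.
    Points of [G] in a common Voronoi cell are within [4 gamma] of each other, and
    every cell contains the ball of radius [gamma / 2] about its centre, hence has
    mass at least [kappa nu0 (gamma / 2) ^ d].
    Let [x] be in [G] and in the cell [V], and let [j] be a label.  If
    [Delta_j x] is at most of the order of [gamma ^ beta], the margin condition
    applies.  If [Delta_j x * mu (V & G)] is less than [4 * mu (V \ G)], the loss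
    summed over the cells is at most [4 * mu (~ G)], of expectation at most
    [4 * exp (- kappa nu0 m gamma ^ d)].  Otherwise the best label at [x] leads
    [j] in [V] by at least [Delta_j x * mu V / 8], so that [j] wins the vote with
    probability at most [exp (- n mu V (Delta_j x) ^ 2 / 512)], and this Gaussian
    tail is integrated against the margin condition by dyadic peeling.
    This gives the bound with a factor [5] before the exponential.  The factor is
    absorbed in [c] when [m gamma ^ d] is large.  When it is bounded, the vote
    returns with high probability a label of conditional mass at least
    [1 / (2 M)] in each cell, so that the excess error is at most
    [1 - 1 / (4 M)] as soon as [n gamma ^ d] is large. *)

From Pilot Require Import Defs.
From HB Require Import structures.
From mathcomp Require Import all_boot all_order all_algebra.
From mathcomp Require Import all_classical all_reals all_analysis.
From mathcomp Require Import measurable_realfun ring lra.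

Set Implicit Arguments.
Unset Strict Implicit.
Unset Printing Implicit Defensive.

Import Order.TTheory GRing.Theory Num.Theory.
Import numFieldNormedType.Exports.

Local Open Scope classical_set_scope.
Local Open Scope ring_scope.

(* MathComp-Analysis has its own [edist] and [eta], which shadow those of [Defs]. *)
Local Notation edist := Pilot.Defs.edist.
Local Notation eta := Pilot.Defs.eta.

(** * Exponential bounds *)

(** Labelled points in [V \ G] may lie arbitrarily far from the centre of [V], where the Hölder
    condition gives no useful control. They are treated as an adversary of mass [mu (V \ G)], hence
    the comparison with [Delta_j x * mu (V & G)] before any concentration is used. Concentration has
    to be of Bernstein type. The difference of two vote counts has terms in {-1, 0, 1} that vanish
    outside the cell, so their second moment is at most [mu V]; a bound by the range alone would
    lose a factor [mu V] in the exponent. The exponent [1 + alpha] arises because each loss is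
    multiplied by the mass of points whose margin is at most of its order: [omega * omega ^ alpha]
    with [omega] of order [gamma ^ beta], and [s * s ^ alpha] with [s] of order
    [(n gamma ^ d) ^ (- 1 / 2)]. The coefficient [1] of the last exponential forces the crude bound:
    for small [m gamma ^ d] that term is close to [1], and shrinking [c] helps only if the excess
    error stays away from [1]. Since [p] is merely a version of the conditional probabilities, its
    values lie in [0, 1] only almost surely; integrals are restricted to a set of regular points of
    full mass. *)

Lemma expR_le_quad {R : realType} (y : R) :
  y <= 2^-1 -> expR y <= 1 + y + 2 * y ^+ 2.
Proof.
move=> y2; have ypos : 0 < 1 - y by lra.
(* This inverts [1 - y <= expR (- y)]. The quadratic times [1 - y] exceeds [1] by [y ^ 2 (1 - 2 y)],
   whence the restriction on [y]. *)
have : expR y <= (1 - y)^-1.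
  rewrite -[leLHS]invrK -expRN lef_pV2 ?posrE ?expR_gt0//.
  by apply: le_trans (expR_ge1Dx _); lra.
move=> /le_trans; apply; rewrite -div1r ler_pdivrMr//.
rewrite -subr_ge0 (_ : _ - _ = y ^+ 2 * (1 - 2 * y)); last by ring.
by rewrite mulr_ge0 ?sqr_ge0//; lra.
Qed.

(* Chernoff's method with exponent [D / (4 v)]. *)
Lemma vote_tail {R : realType} (T : finType) (n : nat) (Q h : T -> R) (v D : R) :
  (forall t, 0 <= Q t) -> \sum_t Q t = 1 ->
  (forall t, `|h t| <= 1) -> 0 <= D <= v -> 0 < v ->
  D <= \sum_t Q t * h t -> \sum_t Q t * h t ^+ 2 <= v ->
  \sum_(c : {ffun 'I_n -> T} | \sum_i h (c i) <= 0) \prod_i Q (c i) <=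
    expR (- (n%:R * (D ^+ 2 / (8 * v)))).
Proof.
move=> Q0 Q1 h1 /andP[D0 Dv] v0 Dh hv.
set s := D / (4 * v).
have s0 : 0 <= s by rewrite divr_ge0// mulr_ge0 ?ltW.
have s1 : s <= 2^-1 by rewrite ler_pdivrMr ?mulr_gt0//; lra.
pose E t := Q t * expR (- (s * h t)).
have E0 t : 0 <= E t by rewrite mulr_ge0 ?expR_ge0.
apply: (@le_trans _ _ (\sum_(c : {ffun 'I_n -> T}) \prod_i E (c i))).
  rewrite big_mkcond/=; apply: ler_sum => c _; case: ifPn => hc; last first.
    by apply: prodr_ge0 => i _.
  rewrite big_split/= ler_peMr//; first by apply: prodr_ge0 => i _.
  rewrite -expR_sum -expR0 ler_expR sumrN -mulr_sumr oppr_ge0.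
  by rewrite mulr_ge0_le0.
rewrite -(bigA_distr_bigA (fun _ : 'I_n => E))/= prodr_const card_ord.
rewrite -mulrN expRM_natl lerXn2r ?nnegrE ?expR_ge0//; first exact: sumr_ge0.
(* The chosen [s] minimises this quadratic, with minimum [1 - D ^ 2 / (8 v)]; [D <= v] keeps [s] in
   the range of [expR_le_quad]. *)
apply: (@le_trans _ _ (1 - s * D + 2 * s ^+ 2 * v)).
  apply: (@le_trans _ _
      (\sum_t (Q t - s * (Q t * h t) + 2 * s ^+ 2 * (Q t * h t ^+ 2)))).
    apply: ler_sum => t _; rewrite /E.
    apply: (@le_trans _ _ (Q t * (1 + - (s * h t) + 2 * (- (s * h t)) ^+ 2)));
      last by lra.
    apply: ler_wpM2l => //; apply: expR_le_quad.
    have := h1 t; rewrite ler_norml => /andP[h1t _].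
    by rewrite -mulrN; apply: le_trans s1; rewrite ler_piMr//; lra.
  rewrite big_split/= big_split/= sumrN -!mulr_sumr Q1.
  apply: lerD; first by rewrite lerD2l lerN2 ler_wpM2l.
  by apply: ler_wpM2l => //; apply: mulr_ge0 => //; exact: sqr_ge0.
apply: le_trans (expR_ge1Dx _).
rewrite le_eqVlt; apply/orP; left; apply/eqP; rewrite /s.
by field; rewrite gt_eqF.
Qed.

(** Since [y >= 1], [y ^ 2] may be lowered to [y], and [expR (- y / 2)] is the [q]-th power of
    [expR (- y / (2 q)) <= 2 q / y]. Passing from [2 ^ k] to [2 ^ (k + 1)] turns the [2 q] into
    [4 q]. *)
Lemma expR_dyadic {R : realType} (q y : R) (k : nat) : 1 <= q -> 2 ^+ k < y ->
  expR (- (y ^+ 2 / 2)) <= (4 * q) `^ q * (2 ^+ k.+1) `^ (- q).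
Proof.
move=> q1 ky; have q0 : 0 < q by apply: lt_le_trans q1.
have y1 : 1 <= y by apply: ltW; apply: le_lt_trans ky; rewrite exprn_ege1// ler1n.
have y0 : 0 < y by apply: lt_le_trans y1.
have k0 : 0 < 2 ^+ k :> R by rewrite exprn_gt0.
apply: (@le_trans _ _ (expR (- (y / (2 * q)) * q))).
  rewrite ler_expR.
  have -> : - (y / (2 * q)) * q = - (y / 2) by field; rewrite gt_eqF.
  by rewrite lerN2 ler_pM2r ?invr_gt0// expr2 ler_peMl// ltW.
have -> : (2 ^+ k.+1) `^ (- q) = ((2 ^+ k.+1)^-1) `^ q :> R.
  rewrite powRN -powR_inv1 ?powR_ge0// powRAC powR_inv1//.
have kge0 : 0 <= (2 ^+ k.+1)^-1 :> R by rewrite invr_ge0 exprn_ge0.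
have q40 : 0 <= 4 * q by lra.
rewrite expRM -powRM//.
rewrite ge0_ler_powR ?nnegrE ?expR_ge0 ?mulr_ge0 ?(ltW q0)//.
apply: (@le_trans _ _ (2 * q / y)).
  rewrite -[leRHS]invf_div expRN lef_pV2 ?posrE ?expR_gt0 ?divr_gt0 ?mulr_gt0//.
  by apply: le_trans (expR_ge1Dx _); lra.
rewrite exprS ler_pdivrMr// (_ : _ / _ = 2 * q / 2 ^+ k); last first.
  by field; rewrite gt_eqF.
rewrite mulrAC ler_pdivlMr// ler_wpM2l ?ltW//.
by rewrite mulr_gt0.
Qed.

(* Peeling over the sets where [e <= 2 ^ k s]. *)
Lemma margin_integral {R : realType} (alpha : R) : 0 < alpha ->
  exists2 K : R, 0 < K & forall d (T : measurableType d) (mu : probability T R)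
    (e : T -> R) (c s : R), measurable_fun setT e -> 0 < s -> 0 <= c ->
    (forall t, 0 < t -> (mu [set x | (e x <= t)%R] <= (c * t `^ alpha)%:E)%E) ->
    (\int[mu]_x (expR (- (e x ^+ 2 / (2 * s ^+ 2))))%:E <= (K * c * s `^ alpha)%:E)%E.
Proof.
(* Decay of order [alpha + 1] beats the growth [2 ^ (k alpha)] of the margin bound by exactly
   [2 ^ (- k)]. The peeled series is then geometric and sums to twice its first term, the [2] of the
   witness. *)
move=> alpha0; set q := alpha + 1.
have q1 : 1 <= q by rewrite /q; lra.
set B := (4 * q) `^ q.
have B0 : 0 < B by rewrite powR_gt0//; lra.
have B1 : 1 <= B by rewrite -(powRr0 (4 * q)) ler_powR//; lra.
exists (2 * B); first by rewrite mulr_gt0.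
move=> d T mu e c s me s0 c0 he.
pose A k := [set x | e x <= 2 ^+ k * s].
have mA k : measurable (A k).
  by rewrite -[X in measurable X]setTI; apply: measurable_fun_le.
pose b k : R := B * (2 ^+ k) `^ (- q).
have b0 k : 0 <= b k by rewrite mulr_ge0 ?powR_ge0// ltW.
have mbA k : measurable_fun setT (fun x => (b k * \1_(A k) x)%:E).
  by apply/measurable_EFinP; apply: measurable_funM => //.
apply: (@le_trans _ _ (\int[mu]_x (\sum_(k <oo) (b k * \1_(A k) x)%:E)%E)%E).
  apply: ge0_le_integral => //.
  - apply/measurable_EFinP; apply: measurableT_comp => //.
    apply: measurableT_comp => //; apply: measurable_funM => //.
    exact: measurable_funX.
  - apply: ge0_emeasurable_sum => //.
    by move=> k x _ _; rewrite lee_fin mulr_ge0.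
  move=> x _.
  have exk : exists k, x \in A k.
    have [k hk] : exists k : nat, e x / s <= k%:R.
      by exists (Num.truncn `|e x / s|).+1; apply: le_trans (ler_norm _) _;
         rewrite ltW// truncnS_gt.
    exists k; rewrite inE /A /= -ler_pdivrMr//; apply: le_trans hk _.
    by rewrite -natrX ler_nat ltnW// ltn_expl.
  (* Only the term of the least [k] is kept. Minimality is the lower bound on [e x / s] that
     [expR_dyadic] asks for; at [k = 0] the coefficient [B >= 1] suffices. *)
  case: (ex_minnP exk) => k xk kmin.
  apply: (@le_trans _ _ (b k * \1_(A k) x)%:E); last first.
    apply: le_trans (nneseries_lim_ge k.+1 _) => //; last first.
      by move=> i _ _; rewrite lee_fin mulr_ge0.
    by rewrite big_nat_recr//= leeDr// sume_ge0// => i _; rewrite lee_fin mulr_ge0.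
  rewrite indicE xk mulr1 lee_fin.
  case: k kmin {xk} => [|k] kmin.
    rewrite /b expr0 powR1 mulr1; apply: le_trans B1.
    rewrite -expR0 ler_expR oppr_le0; apply: divr_ge0; first exact: sqr_ge0.
    by apply: mulr_ge0 => //; exact: sqr_ge0.
  have ek : 2 ^+ k < e x / s.
    rewrite ltr_pdivlMr// ltNge; apply/negP => h.
    by have := kmin k; rewrite inE => /(_ h); rewrite ltnn.
  apply: le_trans (expR_dyadic q1 ek).
  rewrite ler_expR lerN2 le_eqVlt; apply/orP; left; apply/eqP.
  by field; rewrite gt_eqF.
rewrite integral_nneseries//; last first.
  by move=> k x _; rewrite lee_fin mulr_ge0.
have := @cvg_geometric_eseries_half R (2 * B * c * s `^ alpha) 0.
rewrite expr0 divr1 => /cvg_lim <- //.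
apply: lee_nneseries => [k _ _|k _].
  by apply: integral_ge0 => x _; rewrite lee_fin mulr_ge0.
under eq_integral do rewrite EFinM.
rewrite ge0_integralZl//=; last 2 first.
- exact/measurable_EFinP.
- by rewrite lee_fin.
rewrite integral_indic// setIT.
apply: (@le_trans _ _ ((b k)%:E * (c * (2 ^+ k * s) `^ alpha)%:E)%E).
  by apply: lee_wpmul2l; [rewrite lee_fin|apply: he; rewrite mulr_gt0// exprn_gt0].
rewrite -EFinM lee_fin /b powRM ?(ltW s0) ?exprn_ge0//.
have -> : (2 ^+ k) `^ (- q) = (2 ^+ k) `^ (- alpha) / 2 ^+ k :> R.
  rewrite /q opprD powRD; last by apply/implyP => _; apply: lt0r_neq0; exact: exprn_gt0.
  by rewrite powR_inv1.
rewrite powRN natrX addn1 exprS le_eqVlt; apply/orP; left; apply/eqP.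
by field; rewrite !gt_eqF ?powR_gt0 ?exprn_gt0.
Qed.

(** * Euclidean distance and Voronoi cells *)

(** Lagrange's identity: twice the difference of the two sides is the double sum of the squares of
    [a i * b j - a j * b i]. *)
Lemma sum_CauchySchwarz {R : realType} (d : nat) (a b : 'I_d -> R) :
  (\sum_i a i * b i) ^+ 2 <= (\sum_i a i ^+ 2) * (\sum_i b i ^+ 2).
Proof.
have : 0 <= \sum_i \sum_j (a i * b j - a j * b i) ^+ 2.
  by apply: sumr_ge0 => i _; apply: sumr_ge0 => j _; exact: sqr_ge0.
rewrite (_ : \sum_i _ = ((\sum_i a i ^+ 2) * (\sum_i b i ^+ 2)) * 2 -
    (\sum_i a i * b i) ^+ 2 * 2) ?subr_ge0 ?ler_pM2r//.
transitivity (\sum_i \sum_j (a i ^+ 2 * b j ^+ 2 + b i ^+ 2 * a j ^+ 2 -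
    (a i * b i) * (a j * b j) * 2)).
  by apply: eq_bigr => i _; apply: eq_bigr => j _; ring.
under eq_bigr do rewrite !big_split/= sumrN -mulr_suml -!mulr_sumr.
rewrite !big_split/= sumrN -!mulr_suml; ring.
Qed.

Lemma measurable_set_pred d (T : measurableType d) (b : T -> bool) :
  measurable_fun setT b -> measurable [set t | b t].
Proof. by move=> mb; have := mb measurableT [set true]; rewrite setTI; exact. Qed.

Section edist_theory.
Context {R : realType} {d : nat}.
Implicit Types x y z : d.-tuple R.

Lemma edist_ge0 x y : 0 <= edist x y.
Proof. exact: sqrtr_ge0. Qed.

Lemma edistC x y : edist x y = edist y x.
Proof. by congr Num.sqrt; apply: eq_bigr => i _; rewrite -sqrrN opprB. Qed.

Lemma edistxx x : edist x x = 0.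
Proof.
by rewrite /edist big1 ?sqrtr0// => i _; rewrite subrr expr0n.
Qed.

Lemma edist_triangle y x z : edist x z <= edist x y + edist y z.
Proof.
pose a i := tnth x i - tnth y i; pose b i := tnth y i - tnth z i.
have A0 : 0 <= \sum_i a i ^+ 2 by apply: sumr_ge0 => i _; exact: sqr_ge0.
have B0 : 0 <= \sum_i b i ^+ 2 by apply: sumr_ge0 => i _; exact: sqr_ge0.
rewrite -[leRHS]ger0_norm ?addr_ge0 ?edist_ge0// -sqrtr_sqr; apply: ler_wsqrtr.
rewrite sqrrD !sqr_sqrtr//.
apply: (@le_trans _ _ (\sum_i a i ^+ 2 + (\sum_i a i * b i) *+ 2 + \sum_i b i ^+ 2)).
  rewrite -sumrMnl -!big_split/=; apply: ler_sum => i _.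
  by rewrite -sqrrD /a /b addrA subrK.
rewrite lerD2r lerD2l lerMn2r/= -sqrtrM//.
apply: (le_trans (ler_norm _)); rewrite -sqrtr_sqr; apply: ler_wsqrtr.
exact: sum_CauchySchwarz.
Qed.

Lemma measurable_edist dT (T : measurableType dT) (f g : T -> d.-tuple R) :
  measurable_fun setT f -> measurable_fun setT g ->
  measurable_fun setT (fun t => edist (f t) (g t)).
Proof.
move=> mf mg; rewrite /edist.
rewrite (_ : (fun t => _) =
    (@powR R ^~ 2^-1) \o (fun t => \sum_i (tnth (f t) i - tnth (g t) i) ^+ 2));
    last first.
  apply/funext => t /=; rewrite powR12_sqrt//.
  by apply: sumr_ge0 => i _; exact: sqr_ge0.
apply: measurableT_comp => //.
apply: measurable_sum => i; apply: measurable_funX; apply: measurable_funB.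
  by apply: (measurableT_comp (measurable_tnth i)).
by apply: (measurableT_comp (measurable_tnth i)).
Qed.

Lemma measurable_eball x r : measurable (eball x r).
Proof.
apply: measurable_set_pred; apply: measurable_fun_ltr => //.
exact: measurable_edist.
Qed.

End edist_theory.

(** * Geometry and measurability of the Voronoi cells of a net *)

Section voronoi_theory.
Context {R : realType} {d m : nat}.
Implicit Types (xu : m.-tuple (d.-tuple R)) (N : {set 'I_m}) (x : d.-tuple R).

(** Minimising the distance, and then the index among the nearest centres, reproduces the
    tie-breaking of the cells. *)
Lemma voronoi_ex xu N x : N != finset.set0 -> exists l, voronoi xu N l x.
Proof.
move=> /set0Pn[i0 i0N].
pose le i j := (edist x (tnth xu i) < edist x (tnth xu j)) ||
    (edist x (tnth xu i) == edist x (tnth xu j)) && (i <= j)%N.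
have [i iN ile] : exists2 i, i \in N & forall j, j \in N ->
    edist x (tnth xu i) <= edist x (tnth xu j).
  by case: (arg_minP (fun i => edist x (tnth xu i)) i0N) => i iN ile; exists i.
have i1 : (i \in N) && (edist x (tnth xu i) == edist x (tnth xu i)) by rewrite iN/=.
case: (@arg_minnP _ i (fun j => (j \in N) &&
  (edist x (tnth xu j) == edist x (tnth xu i))) (fun j => nat_of_ord j) i1).
move=> l /andP[lN /eqP li] lmin; exists l; rewrite /voronoi lN/=.
apply/forall_inP => j jN; have := ile _ jN; rewrite -li le_eqVlt => /predU1P[e|->//].
by rewrite e ltxx eqxx/= lmin// jN/= -e li.
Qed.

Lemma voronoi_uniq xu N x l l' : voronoi xu N l x -> voronoi xu N l' x -> l = l'.
Proof.
move=> /andP[lN /forall_inP hl] /andP[l'N /forall_inP hl'].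
have := hl _ l'N; have := hl' _ lN.
case: ltgtP => //= _ h1 h2; apply/val_inj/eqP; by rewrite eqn_leq h1 h2.
Qed.

Lemma voronoi_in xu N l x : voronoi xu N l x -> l \in N.
Proof. by case/andP. Qed.

Lemma voronoi_le xu N l x i : voronoi xu N l x -> i \in N ->
  edist x (tnth xu l) <= edist x (tnth xu i).
Proof.
by move=> /andP[_ /forall_inP h] /h /orP[/ltW//|/andP[/eqP->]].
Qed.

(** Separation keeps every other centre at distance more than [gamma / 2] from [x]. This is the
    source of the lower bound on cell masses. *)
Lemma voronoi_half_ball (gamma : R) xu N l x : gamma_separated gamma xu N ->
  l \in N -> edist x (tnth xu l) < gamma / 2 -> voronoi xu N l x.
Proof.
move=> /forall_inP sep lN xl; rewrite /voronoi lN/=; apply/forall_inP => i iN.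
have [<-|li] := eqVneq l i; first by rewrite eqxx leqnn orbT.
have /forall_inP/(_ _ iN)/implyP/(_ li) gli := sep _ lN.
have := edist_triangle x (tnth xu l) (tnth xu i); rewrite (edistC _ x) => h.
by apply/orP; left; lra.
Qed.

(** By maximality: a sample point at distance at least [gamma] from all of [N] could be added to
    it. *)
Lemma gamma_net_near (gamma : R) xu N j : 0 < gamma -> gamma_net gamma xu N ->
  exists2 l, l \in N & edist (tnth xu j) (tnth xu l) < gamma.
Proof.
move=> gamma0 /maxsetP[sep mx].
have [jN|jN] := boolP (j \in N); first by exists j => //; rewrite edistxx.
apply/exists_inP; apply: contraT; rewrite negb_exists_in => /forall_inP far.
suff /mx/(_ (finset.subsetU1 _ _)) jNN : gamma_separated gamma xu (j |: N)%SET.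
  by move: jN; rewrite -jNN finset.setU11.
have farj i : i \in N -> gamma <= edist (tnth xu j) (tnth xu i).
  by move=> /far; rewrite -leNgt.
apply/forall_inP => a aU; apply/forall_inP => b bU; apply/implyP => ab.
move: aU bU ab; rewrite !inE => /predU1P[->|aN] /predU1P[->|bN]; rewrite ?eqxx//.
- by move=> _; exact: farj.
- by move=> _; rewrite edistC; exact: farj.
- by move/forall_inP : sep => /(_ _ aN)/forall_inP/(_ _ bN)/implyP.
Qed.

Lemma gamma_net_neq0 (gamma : R) xu N : 0 < gamma -> (0 < m)%N ->
  gamma_net gamma xu N -> N != finset.set0.
Proof.
move=> gamma0 m0 /(gamma_net_near (Ordinal m0) gamma0)[l lN _].
by apply/set0Pn; exists l.
Qed.

(** The sample point near [x] is itself within [gamma] of a centre, and the nearest centre is no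
    farther from [x]. Two such points of a cell are thus within [4 gamma], the diameter in
    [cell_osc]. *)
Lemma voronoi_near (gamma : R) xu N l j x : 0 < gamma -> gamma_net gamma xu N ->
  voronoi xu N l x -> edist x (tnth xu j) < gamma ->
  edist x (tnth xu l) < 2 * gamma.
Proof.
move=> gamma0 gn vl xj; have [i iN ji] := gamma_net_near j gamma0 gn.
have := voronoi_le vl iN; have := edist_triangle (tnth xu j) x (tnth xu i).
lra.
Qed.

Lemma measurable_voronoi dT (T : measurableType dT) N l
    (f : T -> m.-tuple (d.-tuple R)) (g : T -> d.-tuple R) :
  measurable_fun setT f -> measurable_fun setT g ->
  measurable_fun setT (fun t => voronoi (f t) N l (g t)).
Proof.
move=> mf mg; rewrite /voronoi; apply: measurable_and => //.
under eq_fun do rewrite -big_andE.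
have mft i : measurable_fun setT (fun t => tnth (f t) i).
  by apply: (measurableT_comp (measurable_tnth i)).
have h (s : seq 'I_m) : measurable_fun setT (fun t => \big[andb/true]_(i <- s | i \in N)
    ((edist (g t) (tnth (f t) l) < edist (g t) (tnth (f t) i))
     || (edist (g t) (tnth (f t) l) == edist (g t) (tnth (f t) i)) && (l <= i)%N)).
  elim: s => [|i s ih].
    rewrite (_ : (fun t => _) = cst true)//.
    by apply/funext => t; rewrite big_nil.
  have [iN|/negPf iN] := boolP (i \in N); last first.
    move: ih; congr (measurable_fun _ _); apply/funext => t.
    by rewrite big_cons iN.
  under eq_fun do rewrite big_cons iN.
  apply: measurable_and => //; apply: measurable_or.
    by apply: measurable_fun_ltr; exact: measurable_edist.
  by apply: measurable_and => //; apply: measurable_fun_eqr; exact: measurable_edist.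
exact: h.
Qed.

End voronoi_theory.

(** * Independence *)

Lemma measure_finfiber {R : realType} d (T : measurableType d) (I : finType)
    (mu : {measure set T -> \bar R}) (phi : T -> I) (A : set T) :
  measurable A -> (forall i, measurable (phi @^-1` [set i])) ->
  mu A = (\sum_i mu (A `&` phi @^-1` [set i]))%E.
Proof.
move=> mA mphi.
have h (s : seq I) : uniq s ->
    measurable (A `&` [set x | phi x \in s]) /\
    mu (A `&` [set x | phi x \in s]) = (\sum_(i <- s) mu (A `&` phi @^-1` [set i]))%E.
  elim: s => [_|i s ih /= /andP[iNs us]].
    rewrite big_nil (_ : [set _ | _] = set0) ?setI0 ?measure0//.
    by apply/seteqP; split.
  have [ms mus] := ih us.
  have -> : A `&` [set x | phi x \in i :: s] =
      (A `&` phi @^-1` [set i]) `|` (A `&` [set x | phi x \in s]).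
    rewrite -setIUr; congr (_ `&` _); apply/seteqP; split => x /=; rewrite inE.
      by move=> /orP[/eqP|]; [left|right].
    by move=> [->|->]; rewrite ?eqxx ?orbT.
  have mi : measurable (A `&` phi @^-1` [set i]) by exact: measurableI.
  split; first exact: measurableU.
  rewrite big_cons -mus measureU//.
  apply/seteqP; split => x //= -[] [_ xi] [_]; rewrite xi; exact/negP.
have [_] := h (enum I) (enum_uniq I); rewrite big_enum => <-.
by congr (mu _); apply/seteqP; split => [x Ax|x []//]; split => //=; rewrite mem_enum.
Qed.

Section independence.
Context {R : realType} {disp : measure_display} {Omega : measurableType disp}.
Variable P : probability Omega R.

(** Dynkin's pi-lambda argument: the sets whose preimage is independent of [E] form a lambda-system.
    Keeping [E] fixed lets [indep_tuples] extend one factor at a time. *)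
Lemma indep_generator d (T : measurableType d) (G : set_system T) (U : {RV P >-> T})
    (E : set Omega) :
  measurable E -> @measurable _ T = <<s G >> -> setI_closed G ->
  (forall A, G A -> P (U @^-1` A `&` E) = (P (U @^-1` A) * P E)%E) ->
  forall A, measurable A -> P (U @^-1` A `&` E) = (P (U @^-1` A) * P E)%E.
Proof.
move=> mE mG IG GE A mA.
have mU S : measurable S -> measurable (U @^-1` S).
  by move=> mS; exact: measurable_funPTI.
have fin S : measurable S -> P S = (fine (P S))%:E.
  by move=> mS; rewrite fineK// fin_num_measure.
apply: (dynkin_induction mG IG
  (P := [set S | P (U @^-1` S `&` E) = (P (U @^-1` S) * P E)%E])); last by rewrite -mG.
- by rewrite /= preimage_setT setTI probability_setT mul1e.
- by [].
- move=> S mS /= h; rewrite preimage_setC probability_setC; last exact: mU.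
  rewrite setIC -setDE.
  have -> : P (E `\` U @^-1` S) = (P E - P (E `&` U @^-1` S))%E.
    by apply: measureD => //; [exact: mU|rewrite -ge0_fin_numE// fin_num_measure].
  rewrite setIC h (fin E mE) (fin _ (mU _ mS)).
  by rewrite -EFinM -!EFinB -EFinM mulrBl mul1r.
- move=> F mF tF h /=; rewrite preimage_bigcup setI_bigcupl.
  rewrite measure_bigcup//; last 2 first.
  + by move=> i _; apply: measurableI => //; exact: mU.
  + apply/trivIsetP => i j _ _ ij; rewrite setIACA setIid -preimage_setI.
    by move/trivIsetP : tF => /(_ _ _ I I ij) ->; rewrite preimage_set0 set0I.
  rewrite measure_bigcup//; last 2 first.
  + by move=> i _; exact: mU.
  + apply/trivIsetP => i j _ _ ij; rewrite -preimage_setI.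
    by move/trivIsetP : tF => /(_ _ _ I I ij) ->; rewrite preimage_set0.
  rewrite (fin E)// muleC -nneseriesZl//; apply: eq_eseriesr => i _.
  by rewrite muleC -(fin E)//; exact: h.
Qed.

Definition tuple_box {d} {T : measurableType d} {n} (C : 'I_n -> set T) :
  set (n.-tuple T) := [set t | forall i, C i (tnth t i)].

Lemma tuple_boxE {d} {T : measurableType d} {n} (C : 'I_n -> set T) :
  tuple_box C = \big[setI/setT]_(i < n) ((@tnth n T)^~ i @^-1` C i).
Proof.
rewrite -bigcap_seq; apply/seteqP; split => [t Ct i _|t Ct i]; first exact: Ct.
by apply: Ct; rewrite /= mem_index_enum.
Qed.

Lemma measurable_tuple_boxes {d} {T : measurableType d} {n} :
  @measurable _ (n.-tuple T) =
  <<s [set A | exists2 C : 'I_n -> set T, (forall i, measurable (C i)) &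
               A = tuple_box C] >>.
Proof.
apply/seteqP; split.
  apply: smallest_sub; first exact: smallest_sigma_algebra.
  rewrite -bigcup_seq => A [i _ [B mB <-]]; apply: sub_sigma_algebra.
  exists (fun j => if j == i then B else setT) => [j|]; first by case: ifP.
  rewrite setTI; apply/seteqP; split => t /=.
    by move=> Bt j; case: eqP => [->|].
  by move/(_ i); rewrite eqxx.
apply: smallest_sub; first exact: sigma_algebra_measurable.
move=> _ [C mC ->]; rewrite tuple_boxE; apply: bigsetI_measurable => i _.
by rewrite -[X in measurable X]setTI; exact: measurable_tnth.
Qed.

Lemma setI_closed_tuple_boxes {d} {T : measurableType d} {n} :
  setI_closed [set A : set (n.-tuple T) |
    exists2 C : 'I_n -> set T, (forall i, measurable (C i)) & A = tuple_box C].
Proof.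
move=> _ _ [C mC ->] [C' mC' ->]; exists (fun i => C i `&` C' i).
  by move=> i; exact: measurableI.
apply/seteqP; split => [t [Ct C't] i|t Ct]; first by split; [exact: Ct|exact: C't].
by split => i; have [] := Ct i.
Qed.

Lemma indep_tuples d1 (T1 : measurableType d1) n1 d2 (T2 : measurableType d2) n2
    (U : {RV P >-> n1.-tuple T1}) (D : {RV P >-> n2.-tuple T2}) :
  (forall (B : 'I_n1 -> set T1) (C : 'I_n2 -> set T2),
    (forall i, measurable (B i)) -> (forall i, measurable (C i)) ->
    P (U @^-1` tuple_box B `&` D @^-1` tuple_box C) =
      (P (U @^-1` tuple_box B) * P (D @^-1` tuple_box C))%E) ->
  forall A B, measurable A -> measurable B ->
    P (U @^-1` A `&` D @^-1` B) = (P (U @^-1` A) * P (D @^-1` B))%E.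
Proof.
move=> h A B mA mB.
apply: (indep_generator _ measurable_tuple_boxes setI_closed_tuple_boxes) => //.
  exact: measurable_funPTI.
move=> _ [C mC ->]; rewrite setIC muleC.
have mboxC : measurable (tuple_box C).
  by rewrite measurable_tuple_boxes; apply: sub_sigma_algebra; exists C.
apply: (indep_generator _ measurable_tuple_boxes setI_closed_tuple_boxes) => //.
  exact: measurable_funPTI.
by move=> _ [C' mC' ->]; rewrite setIC muleC; exact: h.
Qed.

(** Independence makes the joint law the product of the marginals, and Tonelli then freezes the
    first variable. This is how conditioning on the unlabeled sample is carried out. *)
Lemma indep_integral d1 (T1 : measurableType d1) d2 (T2 : measurableType d2)
    (U : {RV P >-> T1}) (D : {RV P >-> T2}) (phi : T1 * T2 -> \bar R) :
  (forall A B, measurable A -> measurable B ->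
    P (U @^-1` A `&` D @^-1` B) = (P (U @^-1` A) * P (D @^-1` B))%E) ->
  measurable_fun setT phi -> (forall z, 0 <= phi z)%E ->
  (\int[P]_w phi (U w, D w) = \int[distribution P U]_u \int[P]_w phi (u, D w))%E.
Proof.
move=> UD mphi phi0.
have mW : measurable_fun setT (fun w => (U w, D w)) by exact: measurable_fun_pair.
pose W : {mfun Omega >-> (T1 * T2)%type} := mfun_Sub (mem_set mW).
transitivity (\int[distribution P W]_z phi z)%E.
  by rewrite ge0_integral_distribution.
transitivity (\int[(distribution P U \x distribution P D)%E]_z phi z)%E.
  apply: eq_measure_integral => A mA _; apply/esym.
  apply: product_measure_unique => // B C mB mC.
rewrite fubini_tonelli1//; apply: eq_integral => u _; rewrite /fubini_F.
rewrite ge0_integral_distribution//.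
exact: measurableT_comp.
Qed.

End independence.

Lemma measurable_finfiber d (T : measurableType d) (I : finType) (phi : T -> I)
    (B : set I) :
  (forall i, measurable (phi @^-1` [set i])) -> measurable (phi @^-1` B).
Proof.
move=> mphi; have -> : phi @^-1` B = \bigcup_(i in B) phi @^-1` [set i].
  by apply/seteqP; split => [x Bx|x [i Bi /= ->]//]; exists (phi x).
by apply: fin_bigcup_measurable => //; exact: finite_finset.
Qed.

(** * Tail of a vote whose ballots are finite codes of independent observations *)

Section votes_law.
Context {R : realType} {disp : measure_display} {Omega : measurableType disp}.
Variable P : probability Omega R.
Context {dS : measure_display} {S : measurableType dS} {n : nat}.
Variables (Z0 : {RV P >-> S}) (Z : 'I_n -> {RV P >-> S}).
Hypothesis Zlaw : forall i A, measurable A -> P (Z i @^-1` A) = P (Z0 @^-1` A).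
Hypothesis Zindep : forall B : 'I_n -> set S, (forall i, measurable (B i)) ->
  P (\big[setI/setT]_(i < n) (Z i @^-1` B i)) = (\prod_(i < n) P (Z i @^-1` B i))%E.

(** Coding the observations in a finite type turns a probability about the whole sample into a
    finite sum of products, the setting of [vote_tail]. *)
Lemma finite_law (T : finType) (phi : S -> T) (A : {ffun 'I_n -> T} -> bool) :
  (forall t, measurable (phi @^-1` [set t])) ->
  P [set w | A [ffun i => phi (Z i w)]] =
  (\sum_(c : {ffun 'I_n -> T} | A c)
    \prod_i fine (P (Z0 @^-1` (phi @^-1` [set c i]))))%:E.
Proof.
move=> mphi; pose c w := [ffun i => phi (Z i w)].
have fiberE (t : {ffun 'I_n -> T}) : c @^-1` [set t] =
    \big[setI/setT]_(i < n) (Z i @^-1` (phi @^-1` [set t i])).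
  rewrite -bigcap_seq; apply/seteqP; split => [w /= <- i _|w /= h].
    by rewrite /= ffunE.
  by apply/ffunP => i; rewrite ffunE; apply: h; rewrite /= mem_index_enum.
have mc t : measurable (c @^-1` [set t]).
  rewrite fiberE; apply: bigsetI_measurable => i _.
  exact: measurable_funPTI.
have mA : measurable [set w | A (c w)].
  by rewrite -[X in measurable X]/(c @^-1` [set t | A t]); exact: measurable_finfiber.
rewrite (measure_finfiber P mA mc) -sumEFin [RHS]big_mkcond/=.
apply: eq_bigr => t _; case: ifPn => At.
  rewrite (_ : _ `&` _ = c @^-1` [set t]); last first.
    by apply/seteqP; split => [w []//|w /= cw]; split => //=; rewrite cw.
  rewrite fiberE Zindep// -prodEFin; apply: eq_bigr => i _.
  by rewrite Zlaw// fineK// fin_num_measure//; exact: measurable_funPTI.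
rewrite (_ : _ `&` _ = set0) ?measure0//; apply/seteqP; split => // w /= [+ cw].
by rewrite cw; exact/negP.
Qed.

Lemma vote_prob (T : finType) (phi : S -> T) (h : T -> R) (v D : R) :
  (forall t, measurable (phi @^-1` [set t])) ->
  (forall t, `|h t| <= 1) -> 0 <= D <= v -> 0 < v ->
  let Q t := fine (P (Z0 @^-1` (phi @^-1` [set t]))) in
  D <= \sum_t Q t * h t -> \sum_t Q t * h t ^+ 2 <= v ->
  (P [set w | (\sum_i h (phi (Z i w)) <= 0)%R] <=
    (expR (- (n%:R * (D ^+ 2 / (8 * v)))))%:E)%E.
Proof.
move=> mphi h1 Dv v0 Q DQ Qv.
have mQ t : measurable (Z0 @^-1` (phi @^-1` [set t])) by exact: measurable_funPTI.
have := finite_law (fun c : {ffun 'I_n -> T} => \sum_i h (c i) <= 0) mphi.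
rewrite (_ : [set w | _] = [set w | \sum_i h (phi (Z i w)) <= 0]); last first.
  have E w : \sum_i h ([ffun i => phi (Z i w)] i) = \sum_i h (phi (Z i w)).
    by apply: eq_bigr => i _; rewrite ffunE.
  by apply/seteqP; split => w /=; rewrite E.
move=> ->; rewrite lee_fin; apply: (@vote_tail R T n Q h v D) => //.
- by move=> t; exact: fine_ge0.
- apply: EFin_inj; rewrite -sumEFin -(probability_setT P).
  rewrite (measure_finfiber P measurableT (phi := phi \o Z0))//.
  by apply: eq_bigr => t _; rewrite setTI /Q fineK// fin_num_measure.
Qed.

End votes_law.

Lemma measurable_fun_finfiber {R : realType} d (T : measurableType d)
    (I : finType) (phi : T -> I) (F : I -> T -> R) :
  (forall i, measurable (phi @^-1` [set i])) ->
  (forall i, measurable_fun setT (F i)) ->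
  measurable_fun setT (fun x => F (phi x) x).
Proof.
move=> mphi mF.
rewrite (_ : (fun x => _) =
    (fun x => \sum_i (\1_(phi @^-1` [set i]) x * F i x))); last first.
  apply/funext => x; rewrite (bigD1 (phi x))//= indicE mem_set// mul1r.
  rewrite big1 ?addr0// => i /negP ip.
  by rewrite indicE memNset ?mul0r//= => e; apply: ip; rewrite e.
by apply: measurable_sum => i; apply: measurable_funM.
Qed.

(** * Excess error of a random labelling of disjoint cells *)

Section cells.
Context {R : realType} {dT : measure_display} {T : measurableType dT}.
Variable mu : probability T R.
Context {k m : nat}.
Let M : R := k.+2%:R.
Variables (p : 'I_k.+2 -> T -> R) (A0 : set T).
Hypothesis mp : forall j, measurable_fun setT (p j).
Hypothesis mA0 : measurable A0.
Hypothesis muA0 : mu A0 = 1%E.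
Hypothesis p01 : forall j x, A0 x -> 0 <= p j x <= 1.

Let muR A := fine (mu A).

(* [P (X in A, Y = j)], for [A0] of full measure, see [label_massE]. *)
Definition label_mass j A := fine (\int[mu]_(x in A `&` A0) (p j x)%:E).

Let muRE A : measurable A -> mu A = (muR A)%:E.
Proof. by move=> mA; rewrite fineK// fin_num_measure. Qed.

Let muIA0 A : measurable A -> mu (A `&` A0) = mu A.
Proof.
move=> mA; have m0 : mu (~` A0) = 0%E.
  by rewrite probability_setC// muA0 -EFinB subrr.
rewrite [RHS](measureDI mu mA mA0) [X in (X + _)%E](_ : _ = 0%E) ?add0e//.
apply/eqP; rewrite eq_le measure_ge0 andbT -m0; apply: le_measure.
- by rewrite inE; exact: measurableD.
- by rewrite inE; exact: measurableC.
- by move=> x [].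
Qed.

Let mpE j A : measurable A -> measurable_fun A (fun x => (p j x)%:E).
Proof. by move=> mA; apply/measurable_EFinP; exact: measurable_funTS. Qed.

Let p0E j A x : (A `&` A0) x -> (0 <= (p j x)%:E)%E.
Proof. by move=> [_ /(p01 j)/andP[]]; rewrite lee_fin. Qed.

Let ge_cst_mass j A b : measurable A ->
  (forall x, A x -> A0 x -> p j x <= b) ->
  (\int[mu]_(x in A `&` A0) (p j x)%:E <= (b * muR A)%:E)%E.
Proof.
move=> mA pb; have mAA0 := measurableI _ _ mA mA0.
rewrite EFinM -muRE// -(muIA0 mA) -integral_cst//; apply: ge0_le_integral => //.
- by move=> x; exact: p0E.
- exact: mpE.
- by move=> x [Ax A0x]; rewrite lee_fin pb.
Qed.

Let mass_fin j A : measurable A ->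
  (\int[mu]_(x in A `&` A0) (p j x)%:E = (label_mass j A)%:E)%E.
Proof.
move=> mA; rewrite fineK// ge0_fin_numE.
  apply: le_lt_trans (ge_cst_mass (b := 1) mA _) (ltry _).
  by move=> x _ /(p01 j)/andP[].
by apply: integral_ge0 => x; exact: p0E.
Qed.

Let muRI A B : measurable A -> measurable B ->
  muR A = muR (A `&` B) + muR (A `\` B).
Proof.
move=> mA mB; apply: EFin_inj; rewrite EFinD -!muRE//.
- by rewrite addeC; exact: measureDI.
- exact: measurableD.
- exact: measurableI.
Qed.

Lemma label_mass_le j A b : measurable A ->
  (forall x, A x -> A0 x -> p j x <= b) -> label_mass j A <= b * muR A.
Proof. by move=> mA pb; rewrite -lee_fin -mass_fin//; exact: ge_cst_mass. Qed.

Lemma label_mass_ge j A b : measurable A -> 0 <= b ->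
  (forall x, A x -> A0 x -> b <= p j x) -> b * muR A <= label_mass j A.
Proof.
move=> mA b0 pb; rewrite -lee_fin -mass_fin//.
have mAA0 := measurableI _ _ mA mA0.
rewrite EFinM -muRE// -(muIA0 mA) -integral_cst//; apply: ge0_le_integral => //.
- exact: mpE.
- by move=> x [Ax A0x]; rewrite lee_fin pb.
Qed.

Lemma label_mass_ge0 j A : 0 <= label_mass j A.
Proof. by apply: fine_ge0; apply: integral_ge0 => x; exact: p0E. Qed.

Lemma label_massI j A B : measurable A -> measurable B ->
  label_mass j A = label_mass j (A `&` B) + label_mass j (A `\` B).
Proof.
move=> mA mB; have mAB := measurableI _ _ mA mB; have mADB := measurableD mA mB.
apply: EFin_inj; rewrite EFinD -!mass_fin//.
rewrite -ge0_integral_setU; last 5 first.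
- exact: measurableI.
- exact: measurableI.
- by apply: mpE; apply: measurableU; exact: measurableI.
- by move=> x [|] [_ A0x]; apply: (@p0E _ setT); split.
- apply/disj_setPS => x [[[_ Bx] _] [[_ nBx] _]] //.
by rewrite -setIUl setUIDK.
Qed.

(** * Disjoint cells with random labels, and the crude bound *)

Variables (V : 'I_m -> set T) (G : set T).
Hypothesis mV : forall l, measurable (V l).
Hypothesis mG : measurable G.
Hypothesis tV : forall l l' x, V l x -> V l' x -> l = l'.

Lemma sum_cells_le1 : \sum_l muR (V l) <= 1.
Proof.
rewrite -lee_fin -sumEFin.
apply: (@le_trans _ _ (mu (\big[setU/set0]_l V l))); last first.
  by apply: probability_le1; exact: bigsetU_measurable.
rewrite measure_semi_additive_ord//; last 2 first.
- apply/trivIsetP => i j _ _ ij; rewrite -subset0 => x [Vi Vj].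
  by move: ij; rewrite (tV Vi Vj) eqxx.
- exact: bigsetU_measurable.
by apply: lee_sum => l _; rewrite -muRE.
Qed.

Lemma sum_cells_setD_le : \sum_l muR (V l `\` G) <= muR (~` G).
Proof.
have mVG l : measurable (V l `\` G) by exact: measurableD.
rewrite -lee_fin -sumEFin -muRE; last exact: measurableC.
apply: (@le_trans _ _ (mu (\big[setU/set0]_l (V l `\` G)))); last first.
  apply: le_measure.
  - by rewrite inE; apply: bigsetU_measurable => l _.
  - by rewrite inE; exact: measurableC.
  - by rewrite -bigcup_seq => x [l _ []].
rewrite measure_semi_additive_ord//; last 2 first.
- apply/trivIsetP => i j _ _ ij; rewrite -subset0 => x [[Vi _] [Vj _]].
  by move: ij; rewrite (tV Vi Vj) eqxx.
- by apply: bigsetU_measurable => l _.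
by apply: lee_sum => l _; rewrite -muRE.
Qed.

Variables (b : T -> 'I_k.+2) (lambda : 'I_m -> 'I_k.+2 -> R).
Hypothesis mb : forall j, measurable (b @^-1` [set j]).
Hypothesis pb : forall j x, p j x <= p (b x) x.
Hypothesis lambda0 : forall l j, 0 <= lambda l j.
Hypothesis lambda1 : forall l, \sum_j lambda l j = 1.

Let Delta j x := p (b x) x - p j x.

Let Delta0 j x : 0 <= Delta j x. Proof. by rewrite subr_ge0. Qed.

Let mDelta j : measurable_fun setT (Delta j).
Proof.
by apply: measurable_funB => //; exact: (measurable_fun_finfiber (F := p)).
Qed.

(* Expected loss at [x] when the cell [V l] gets the label [j] with probability
   [lambda l j]. *)
Definition cell_regret x :=
  \sum_l \sum_j \1_(V l) x * (lambda l j * Delta j x).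

Lemma cell_regret_ge0 x : 0 <= cell_regret x.
Proof.
by apply: sumr_ge0 => l _; apply: sumr_ge0 => j _; rewrite !mulr_ge0.
Qed.

Lemma measurable_cell_regret : measurable_fun setT cell_regret.
Proof.
apply: measurable_sum => l; apply: measurable_sum => j.
by apply: measurable_funM => //; apply: measurable_funM.
Qed.

Let cell_regretE l x : V l x -> cell_regret x = \sum_j lambda l j * Delta j x.
Proof.
move=> Vlx; rewrite /cell_regret (bigD1 l)//= [X in _ + X]big1 ?addr0; last first.
  move=> i il; rewrite big1// => j _; rewrite indicE memNset ?mul0r// => Vix.
  by move: il; rewrite (tV Vix Vlx) eqxx.
by apply: eq_bigr => j _; rewrite indicE mem_set// mul1r.
Qed.

Let cell_regret_out x : (forall l, ~ V l x) -> cell_regret x = 0.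
Proof.
move=> Vx; rewrite /cell_regret big1// => l _; rewrite big1// => j _.
by rewrite indicE memNset ?mul0r.
Qed.

(** [a] stands for the number of labeled points, and [tail] for the concentration of the vote within
    one cell. *)
Variable a : R.
Hypothesis a0 : 0 <= a.
Hypothesis tail : forall l j j' D, V l !=set0 -> 0 <= D <= muR (V l) ->
  D <= label_mass j' (V l) - label_mass j (V l) ->
  lambda l j <= expR (- (a * (D ^+ 2 / (8 * muR (V l))))).

Let muR_ge0 A : 0 <= muR A. Proof. exact: fine_ge0. Qed.

Variable v0 : R.
Hypothesis v00 : 0 < v0.
Hypothesis vV : forall l, V l !=set0 -> v0 <= muR (V l `&` G).

Let vV' l : V l !=set0 -> v0 <= muR (V l).
Proof.
by move=> /vV/le_trans; apply; rewrite (muRI (mV l) mG) lerDl.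
Qed.

(* In each cell, labels of mass less than [mu (V l) / (2 M)] are unlikely to beat
   the most frequent one, whose mass is at least [mu (V l) / M]. *)
Lemma cell_regret_crude :
  (forall l, \sum_j label_mass j (V l) = muR (V l)) ->
  (\int[mu]_(x in A0) (cell_regret x)%:E <=
    (1 - (2 * M)^-1 + M * expR (- (a * v0 / (32 * M ^+ 2))))%:E)%E.
Proof.
move=> sum_mass.
have M0 : 0 < M by rewrite ltr0n.
have M1 : 1 <= M by rewrite ler1n.
set e := expR _.
(* Replacing the Bayes value by [1] makes the loss linear in [p j], so that its integral over a cell
   involves label masses only. *)
pose H l j x := \1_(V l) x * (lambda l j * (1 - p j x)).
have H0 l j x : A0 x -> 0 <= H l j x.
  by move=> /(p01 j)/andP[_ pj1]; rewrite !mulr_ge0// subr_ge0.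
have mH l j : measurable_fun setT (H l j).
  by apply: measurable_funM => //; apply: measurable_funM => //; exact: measurable_funB.
apply: (@le_trans _ _ (\int[mu]_(x in A0) (\sum_l \sum_j (H l j x)%:E))%E).
  apply: ge0_le_integral => //.
  - by move=> x _; rewrite lee_fin cell_regret_ge0.
  - by apply/measurable_EFinP; apply: measurable_funTS; exact: measurable_cell_regret.
  - apply: emeasurable_sum => l; apply: emeasurable_sum => j.
    by apply/measurable_EFinP; exact: measurable_funTS.
  - move=> x A0x; rewrite (eq_bigr (fun l => (\sum_j H l j x)%:E)); last first.
      by move=> l _; rewrite sumEFin.
    rewrite sumEFin lee_fin; apply: ler_sum => l _; apply: ler_sum => j _.
    rewrite ler_wpM2l// ler_wpM2l// lerD2r.
    by have /andP[] := p01 (b x) A0x.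
rewrite ge0_integral_sum//; last 2 first.
- by move=> l; apply: emeasurable_sum => j; apply/measurable_EFinP; exact: measurable_funTS.
- by move=> l x A0x; apply: sume_ge0 => j _; rewrite lee_fin H0.
have intH l j : (\int[mu]_(x in A0) (H l j x)%:E =
    (lambda l j * (muR (V l) - label_mass j (V l)))%:E)%E.
  under eq_integral => x xA0 do rewrite /H mulrCA EFinM.
  rewrite ge0_integralZl//; last 3 first.
  - apply/measurable_EFinP; apply: measurable_funTS; apply: measurable_funM => //.
    exact: measurable_funB.
  - by move=> x /(p01 j)/andP[_ pj1]; rewrite lee_fin mulr_ge0// subr_ge0.
  - by rewrite lee_fin.
  rewrite EFinM; congr (_ * _)%E.
  have -> : (\int[mu]_(x in A0) (\1_(V l) x * (1 - p j x))%:E =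
      \int[mu]_(x in V l `&` A0) (1 - p j x)%:E)%E.
    rewrite [LHS]integral_mkcond [RHS]integral_mkcond; apply: eq_integral => x _.
    rewrite !patchE in_setI indicE; case: ifPn => xA; last by rewrite andbF.
    by rewrite andbT; case: ifPn => _; rewrite ?mul1r ?mul0r.
  rewrite EFinB -muRE// -(muIA0 (mV l)) -mass_fin//.
  have <- : (\int[mu]_(x in V l `&` A0) (1 - p j x)%:E +
      \int[mu]_(x in V l `&` A0) (p j x)%:E = mu (V l `&` A0))%E.
    rewrite -ge0_integralD//=; last 5 first.
    + exact: measurableI.
    + by move=> x [_ /(p01 j)/andP[_ pj1]]; rewrite lee_fin subr_ge0.
    + apply/measurable_EFinP; apply: measurable_funTS; exact: measurable_funB.
    + by move=> x; exact: p0E.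
    + by apply: mpE; exact: measurableI.
    under eq_integral do rewrite -EFinD subrK.
    by rewrite integral_cst ?mul1e//; exact: measurableI.
  by rewrite addeK// mass_fin.
have -> : (\sum_(l < m) \int[mu]_(x in A0) (\sum_j (H l j x)%:E) =
    (\sum_l \sum_j lambda l j * (muR (V l) - label_mass j (V l)))%:E)%E.
  rewrite -sumEFin; apply: eq_bigr => l _; rewrite ge0_integral_sum//; last 2 first.
  - by move=> j; apply/measurable_EFinP; exact: measurable_funTS.
  - by move=> j x A0x; rewrite lee_fin H0.
  by rewrite -sumEFin; apply: eq_bigr => j _.
rewrite lee_fin.
apply: (@le_trans _ _ (\sum_l muR (V l) * (1 - (2 * M)^-1 + M * e))); last first.
  rewrite -mulr_suml; apply: ler_piMl; last exact: sum_cells_le1.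
  apply: addr_ge0; last by rewrite mulr_ge0 ?expR_ge0// (ltW M0).
  by rewrite subr_ge0 invf_le1 ?mulr_gt0//; lra.
apply: ler_sum => l _.
have [Vl|/set0P/negP/negbNE/eqP Vl] := pselect (V l !=set0); last first.
  have vl0 : muR (V l) = 0 by rewrite Vl /muR measure0.
  rewrite vl0 mul0r big1// => j _; rewrite sub0r.
  have := sum_mass l; rewrite vl0 => /eqP; rewrite psumr_eq0.
    by move=> /allP/(_ j); rewrite mem_index_enum => /(_ isT)/eqP->; rewrite oppr0 mulr0.
  by move=> i _; exact: label_mass_ge0.
set v := muR (V l); have vpos : 0 < v by apply: lt_le_trans v00 (vV' Vl).
have [j' j'M] : exists j', v / M <= label_mass j' (V l).
  apply: contrapT => /forallNP h.
  have : \sum_(j < k.+2) label_mass j (V l) < \sum_(j < k.+2) v / M.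
    apply: ltr_sum => [|j _]; first by apply/hasP; exists ord0; rewrite ?mem_index_enum.
    by have /negP := h j; rewrite -ltNge.
  by rewrite sum_mass sumr_const card_ord -mulr_natr -/M divfK ?ltxx// gt_eqF.
apply: (@le_trans _ _ (\sum_(j < k.+2) (lambda l j * (v * (1 - (2 * M)^-1)) + v * e))).
  apply: ler_sum => j _.
  have vj : v - label_mass j (V l) <= v by rewrite lerBlDr lerDl label_mass_ge0.
  have [hj|hj] := leP (v / (2 * M)) (label_mass j (V l)).
    apply: (@le_trans _ _ (lambda l j * (v * (1 - (2 * M)^-1)))).
      by rewrite ler_wpM2l// mulrBr mulr1 lerB.
    by rewrite lerDl mulr_ge0 ?expR_ge0// ltW.
  (* The gap to the most frequent label is at least [v / M - v / (2 M)], that is [v / (2 M)]; its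
     square over [8 v] gives the [32 M ^ 2] of the exponent. *)
  have le : lambda l j <= e.
    have D2 : v / (2 * M) = v / M / 2 by field; rewrite gt_eqF.
    have D0 : 0 <= v / (2 * M) <= muR (V l).
      have M20 : 0 < 2 * M by rewrite mulr_gt0.
      rewrite divr_ge0 ?(ltW vpos) ?(ltW M20)//= -/v ler_pdivrMr//.
      by rewrite ler_peMr ?(ltW vpos)//; lra.
    have D1 : v / (2 * M) <= label_mass j' (V l) - label_mass j (V l).
      by move: hj j'M; rewrite D2; move: (v / M) => q; lra.
    apply: le_trans (tail Vl D0 D1) _.
    rewrite ler_expR lerN2 -/v -mulrA ler_wpM2l//.
    have -> : (v / (2 * M)) ^+ 2 / (8 * v) = v / (32 * M ^+ 2).
      by field; rewrite !gt_eqF.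
    by rewrite ler_pM2r ?vV'// invr_gt0 mulr_gt0 ?exprn_gt0.
  apply: (@le_trans _ _ (e * v)); last first.
    rewrite mulrC lerDr !mulr_ge0 ?(ltW vpos)// subr_ge0 invf_le1 ?mulr_gt0//; lra.
  apply: (@le_trans _ _ (lambda l j * v)); first by rewrite ler_wpM2l.
  by rewrite ler_wpM2r ?(ltW vpos).
rewrite big_split/= -mulr_suml lambda1 mul1r sumr_const card_ord [leRHS]mulrDr.
by rewrite lerD2l -mulr_natr -/M -mulrA (mulrC e).
Qed.

(** * The main bound, in terms of oscillation, margin and far mass *)

Variables (eta : T -> R) (omega s : R).
Hypothesis meta : measurable_fun setT eta.
Hypothesis eta_ge0 : forall x, 0 <= eta x.
Hypothesis eta_le : forall j x, 0 < Delta j x -> eta x <= Delta j x.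
Hypothesis omega0 : 0 <= omega.
Hypothesis osc : forall l j x x', V l x -> G x -> V l x' -> G x' ->
  p j x <= p j x' + omega.
Hypothesis s0 : 0 < s.
Hypothesis sE : a * v0 * s ^+ 2 = 8 ^+ 3.

(** [sE] makes the vote exponent [a * v0 * y ^ 2 / 8 ^ 3] equal to [(y / s) ^ 2]. The weight [w]
    keeps half of it; the other half is spent in [gap_tail]. *)
Let w x := expR (- (eta x ^+ 2 / (2 * s ^+ 2))).

Let low := [set x | eta x <= 4 * omega].

Let mlow : measurable low.
Proof. by apply: measurable_set_pred; apply: measurable_fun_ler. Qed.

(** This constant, integrated over the part of the cell in [G], returns four times the mass of the
    part outside. For an empty cell the division by zero gives [0]. *)
Let ratio l := 4 * muR (V l `\` G) / muR (V l `&` G).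

Let ratio0 l : 0 <= ratio l.
Proof. by rewrite /ratio divr_ge0// mulr_ge0. Qed.

(** With [z = y / s], half of the exponent absorbs the linear factor through
    [z <= 1 + z ^ 2 / 2 <= expR (z ^ 2 / 2)]. The factor [s] gained here raises the margin rate from
    [alpha] to [1 + alpha]. *)
Lemma gap_tail y : 0 <= y -> y * expR (- (a * v0 * y ^+ 2 / 8 ^+ 3)) <=
  s * expR (- (y ^+ 2 / (2 * s ^+ 2))).
Proof.
have apos : 0 < a.
  rewrite lt_neqAle a0 andbT; apply/eqP => ae.
  by move: sE; rewrite -ae !mul0r; lra.
move=> y0; have -> : a * v0 * y ^+ 2 / 8 ^+ 3 =
    y ^+ 2 / (2 * s ^+ 2) + y ^+ 2 / (2 * s ^+ 2).
  by rewrite -sE; field; rewrite !gt_eqF.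
rewrite opprD expRD mulrA ler_wpM2r ?expR_ge0// expRN ler_pdivrMr ?expR_gt0//.
rewrite mulrC -ler_pdivrMr//; apply: le_trans (expR_ge1Dx _).
have -> : y ^+ 2 / (2 * s ^+ 2) = (y / s) ^+ 2 / 2 by field; rewrite gt_eqF.
by have := sqr_ge0 (y / s - 1); set z := y / s; rewrite expr2; lra.
Qed.

(** One summand for each regime: gaps hidden by the oscillation, gaps that the far part of the cell
    can overturn, and gaps detected by the vote. In the third [lambda l j] has been spent on the
    tail, so summing over labels will cost a factor [M]. *)
Let cell_regret_label l j x : A0 x -> V l x -> G x ->
  lambda l j * Delta j x <=
  lambda l j * (4 * omega * \1_low x) + lambda l j * ratio l + s * w x.
Proof.
move=> A0x Vx Gx.
have Vl : V l !=set0 by exists x.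
set D := Delta j x; set MG := muR (V l `&` G); set MB := muR (V l `\` G).
have MG0 : 0 < MG by apply: lt_le_trans v00 (vV Vl).
have MB0 : 0 <= MB by exact: muR_ge0.
have vE : muR (V l) = MG + MB by rewrite (muRI (mV l) mG).
have D0 : 0 <= D by exact: Delta0.
have D1 : D <= 1.
  by have := p01 j A0x; have := p01 (b x) A0x; rewrite /D /Delta; lra.
have w0 : 0 <= s * w x by rewrite mulr_ge0 ?expR_ge0// ltW.
have t0 : 0 <= lambda l j * (4 * omega * \1_low x) by rewrite !mulr_ge0.
have r0 : 0 <= lambda l j * ratio l by rewrite mulr_ge0.
have [Dpos|] := ltP 0 D; last first.
  move=> Dneg; have -> : D = 0 by apply/eqP; rewrite eq_le Dneg D0.
  by rewrite mulr0 !addr_ge0.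
have [Dt|Dt] := leP D (4 * omega).
  rewrite -addrA ler_wpDr ?addr_ge0// ler_wpM2l// indicE mem_set ?mulr1//.
  by apply: le_trans Dt; exact: eta_le.
have [Db|Db] := leP (D * MG) (4 * MB).
  rewrite -addrA addrCA ler_wpDr ?addr_ge0// ler_wpM2l//.
  by rewrite /ratio ler_pdivlMr.
rewrite ler_wpDl ?addr_ge0//.
have mVG : measurable (V l `&` G) by exact: measurableI.
have mVB : measurable (V l `\` G) by exact: measurableD.
(* The worst case is assumed outside [G]: there all the mass goes to [j] in [hj] and none to the
   Bayes label in [hb]. *)
have hj : label_mass j (V l) <= (p j x + omega) * MG + MB.
  rewrite (label_massI j (mV l) mG) lerD//.
    by apply: label_mass_le => // y [Vy Gy] _; exact: (osc _ Vy Gy Vx Gx).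
  rewrite -[leRHS]mul1r; apply: label_mass_le => // y _ /(p01 j)/andP[//].
have hb : (p (b x) x - omega) * MG <= label_mass (b x) (V l).
  rewrite (label_massI (b x) (mV l) mG).
  apply: (@le_trans _ _ (label_mass (b x) (V l `&` G))); last first.
    by rewrite lerDl label_mass_ge0.
  have po : 0 <= p (b x) x - omega.
    by have /andP[pj0 _] := p01 j A0x; have := omega0; move: Dt; rewrite /D /Delta; lra.
  apply: label_mass_ge => // y [Vy Gy] _.
  by rewrite lerBlDr; exact: (osc _ Vx Gx Vy Gy).
have v1 : 0 < muR (V l) by rewrite vE; lra.
have := @tail l j (b x) (D * muR (V l) / 8) Vl.
have h1 : 0 <= D * muR (V l) / 8 <= muR (V l).
  have := ler_piMl (ltW v1) D1; have := mulr_ge0 D0 (ltW v1).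
  by rewrite -/D; lra.
(* From [4 omega < D] the lead inside [G] is at least [(D / 2) MG]. Since [4 MB < D MG] and
   [D <= 1], an eighth of [D (MG + MB)] survives the subtraction of [MB]. *)
have h2 : D * muR (V l) / 8 <= label_mass (b x) (V l) - label_mass j (V l).
  apply: (@le_trans _ _ ((D / 2) * MG - MB)).
    by have := ler_piMl MB0 D1; rewrite vE; lra.
  have := ler_wpM2r (ltW MG0) (ltW Dt).
  by move: hb hj; rewrite /D /Delta; lra.
move=> /(_ h1 h2) le.
apply: (@le_trans _ _ (D * expR (- (a * v0 * D ^+ 2 / 8 ^+ 3)))).
  rewrite mulrC ler_wpM2l// (le_trans le)// ler_expR lerN2.
  have -> : (D * muR (V l) / 8) ^+ 2 / (8 * muR (V l)) = muR (V l) * D ^+ 2 / 8 ^+ 3.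
    by field; rewrite gt_eqF.
  rewrite (_ : a * v0 * D ^+ 2 / 8 ^+ 3 = a * (v0 * (D ^+ 2 / 8 ^+ 3))); last by ring.
  rewrite -(mulrA (muR _)) ler_wpM2l// ler_wpM2r ?vV'//.
  by apply: divr_ge0; [exact: sqr_ge0|exact: exprn_ge0].
apply: le_trans (gap_tail D0) _; rewrite ler_wpM2l ?(ltW s0)// ler_expR lerN2.
apply: ler_wpM2r; first by rewrite invr_ge0; apply: mulr_ge0 => //; exact: sqr_ge0.
by rewrite ler_sqr ?nnegrE//; exact: eta_le.
Qed.

Let M0 : 0 <= M. Proof. by rewrite ler0n. Qed.

Let w_ge0 x : 0 <= w x. Proof. exact: expR_ge0. Qed.

Let mw : measurable_fun setT w.
Proof.
apply: measurableT_comp => //; apply: measurableT_comp => //.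
by apply: measurable_funM => //; exact: measurable_funX.
Qed.

Let bound x := 4 * omega * \1_low x + \sum_l ratio l * \1_(V l `&` G) x +
  \1_(~` G) x + M * s * w x.

Let Mw0 x : 0 <= M * s * w x. Proof. by rewrite !mulr_ge0// ltW. Qed.

Let sum0 x : 0 <= \sum_l ratio l * \1_(V l `&` G) x.
Proof. by apply: sumr_ge0 => l _; rewrite mulr_ge0. Qed.

Let low0 x : 0 <= 4 * omega * \1_low x. Proof. by rewrite !mulr_ge0. Qed.

Let cell_regret_le_bound x : A0 x -> cell_regret x <= bound x.
Proof.
move=> A0x; rewrite /bound.
have [[l Vlx]|nV] := pselect (exists l, V l x); last first.
  rewrite cell_regret_out; last by move=> l Vlx; apply: nV; exists l.
  by rewrite !addr_ge0.
rewrite (cell_regretE Vlx).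
have [Gx|nGx] := pselect (G x); last first.
  rewrite (_ : \1_(~` G) x = 1); last by rewrite indicE mem_set.
  apply: (@le_trans _ _ 1); last by rewrite -addrA addrCA lerDl !addr_ge0.
  rewrite -(lambda1 l); apply: ler_sum => j _; rewrite ler_piMr//.
  by have := p01 j A0x; have := p01 (b x) A0x; rewrite /Delta; lra.
apply: (@le_trans _ _ (4 * omega * \1_low x + ratio l + M * s * w x)).
  apply: (le_trans (ler_sum _ (fun j _ => cell_regret_label j A0x Vlx Gx))).
  rewrite !big_split/= -!mulr_suml lambda1 !mul1r sumr_const card_ord.
  by rewrite -[X in X * w x](mulr_natl s).
rewrite lerD2r -addrA lerD2l ler_wpDr// (bigD1 l)//= indicE mem_set// mulr1.
by rewrite lerDl; apply: sumr_ge0 => i _; rewrite mulr_ge0.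
Qed.

(** The factor [5] is [4] from the [ratio] terms summed over the cells, plus [1] from the points
    outside [G], where the loss is only bounded by [1]. *)
Lemma cell_regret_main :
  (\int[mu]_(x in A0) (cell_regret x)%:E <=
    (4 * omega)%:E * mu low + (5 * muR (~` G))%:E + (M * s)%:E * \int[mu]_x (w x)%:E)%E.
Proof.
have mlowf : measurable_fun A0 (fun x => (4 * omega * \1_low x)%:E).
  by apply/measurable_EFinP; exact: measurable_funM.
have mVG l : measurable (V l `&` G) by exact: measurableI.
have msum : measurable_fun A0 (fun x => (\sum_l ratio l * \1_(V l `&` G) x)%:E).
  apply/measurable_EFinP; apply: measurable_sum => l; exact: measurable_funM.
have mGC : measurable (~` G) by exact: measurableC.
have mMw : measurable_fun A0 (fun x => (M * s * w x)%:E).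
  by apply/measurable_EFinP; apply: measurable_funM => //; exact: measurable_funTS.
have mind : measurable_fun A0 (fun x => (\1_(~` G) x : R)%:E).
  by apply/measurable_EFinP; exact: measurable_indic.
apply: (@le_trans _ _ (\int[mu]_(x in A0) (bound x)%:E)%E).
  apply: ge0_le_integral => //.
  - by move=> x _; rewrite lee_fin cell_regret_ge0.
  - by apply/measurable_EFinP; apply: measurable_funTS; exact: measurable_cell_regret.
  - rewrite /bound; under eq_fun do rewrite !EFinD.
    apply: emeasurable_funD; last exact: mMw.
    apply: emeasurable_funD; last exact: mind.
    exact: emeasurable_funD mlowf msum.
rewrite /bound; under eq_integral do rewrite !EFinD.
rewrite ge0_integralD//; last 3 first.
- by move=> x _; rewrite -!EFinD lee_fin !addr_ge0.
- apply: emeasurable_funD; last exact: mind.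
  exact: emeasurable_funD mlowf msum.
- by move=> x _; rewrite lee_fin; exact: Mw0.
rewrite ge0_integralD//; last 2 first.
- by move=> x _; rewrite -!EFinD lee_fin addr_ge0.
- exact: emeasurable_funD mlowf msum.
rewrite ge0_integralD//; last 2 first.
- by move=> x _; rewrite lee_fin; exact: low0.
- by move=> x _; rewrite lee_fin; exact: sum0.
have subA0 A : measurable A -> (mu (A `&` A0) <= mu A)%E.
  by move=> mA; rewrite muIA0.
apply: leeD; last first.
  under eq_integral do rewrite EFinM.
  rewrite ge0_integralZl//; last 3 first.
  - by apply/measurable_EFinP; exact: measurable_funTS.
  - by move=> x _; rewrite lee_fin.
  - by rewrite lee_fin mulr_ge0// ltW.
  apply: lee_wpmul2l; first by rewrite lee_fin mulr_ge0// ltW.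
  apply: ge0_subset_integral => //; first exact/measurable_EFinP.
  by move=> x _; rewrite lee_fin; exact: w_ge0.
rewrite -addeA; apply: leeD.
  under eq_integral do rewrite EFinM.
  rewrite ge0_integralZl//; last 2 first.
  - by apply/measurable_EFinP; exact: measurable_indic.
  - by rewrite lee_fin mulr_ge0.
  by rewrite integral_indic//; apply: lee_wpmul2l; [rewrite lee_fin mulr_ge0|exact: subA0].
have int_indic A : measurable A ->
    (\int[mu]_(x in A0) (\1_A x : R)%:E)%E = (muR A)%:E.
  by move=> mA; rewrite integral_indic// -muRE//; exact: muIA0.
rewrite int_indic//.
apply: (@le_trans _ _ ((4 * muR (~` G))%:E + (muR (~` G))%:E)%E); last first.
  by rewrite -EFinD lee_fin; lra.
rewrite leeD2r//; under eq_integral do rewrite -sumEFin.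
rewrite ge0_integral_sum//; last 2 first.
- by move=> l; apply/measurable_EFinP; exact: measurable_funM.
- by move=> l x _; rewrite lee_fin mulr_ge0.
apply: (@le_trans _ _ (\sum_l (4 * muR (V l `\` G))%:E)%E); last first.
  by rewrite sumEFin lee_fin -mulr_sumr ler_wpM2l// sum_cells_setD_le.
apply: lee_sum => l _; under eq_integral do rewrite EFinM.
rewrite ge0_integralZl//; last 2 first.
- by apply/measurable_EFinP; exact: measurable_indic.
- by rewrite lee_fin.
rewrite int_indic// -EFinM lee_fin /ratio.
have [->|nz] := eqVneq (muR (V l `&` G)) 0; first by rewrite mulr0 mulr_ge0.
by rewrite divfK.
Qed.
End cells.

(** * Bayes rule, margin and regular points *)

Lemma null_of_integral0 {R : realType} d (T : measurableType d)
    (mu : {measure set T -> \bar R}) (A : set T) (g : T -> R) :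
  measurable A -> measurable_fun setT g -> (forall x, A x -> 0 < g x) ->
  (\int[mu]_(x in A) (g x)%:E = 0)%E -> mu A = 0%E.
Proof.
move=> mA mg g0 ig.
have mgA : measurable_fun A (EFin \o g).
  by apply/measurable_EFinP; exact: measurable_funTS.
have [+ _] := ae_eq_integral_abs mu mA mgA.
have -> : (\int[mu]_(x in A) `|(EFin \o g) x| = 0)%E.
  rewrite -ig; apply: eq_integral => x /[!inE] Ax /=.
  by rewrite ger0_norm// ltW// g0.
move=> /(_ erefl) [N [mN N0 hN]].
apply/eqP; rewrite eq_le measure_ge0 andbT -N0; apply: le_measure; rewrite ?inE//.
move=> x Ax; apply: hN => /= h; have := h Ax => -[] gx0.
by have := g0 _ Ax; rewrite gx0 ltxx.
Qed.

Section argmax.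
Context {R : realType} {d k : nat}.
Local Notation T := (d.-tuple R).

(* The Bayes rule and the ranking of the classes at a point only depend on this
   finite pattern, whence their measurability. *)
Let order_pattern (q : 'I_k.+2 -> R) : {ffun 'I_k.+2 * 'I_k.+2 -> bool} :=
  [ffun ij => q ij.1 <= q ij.2].

Let measurable_order_pattern (p : 'I_k.+2 -> T -> R) e :
  (forall j, measurable_fun setT (p j)) ->
  measurable ((fun x => order_pattern (p ^~ x)) @^-1` [set e]).
Proof.
move=> mp.
rewrite (_ : _ @^-1` _ = \big[setI/setT]_(ij : 'I_k.+2 * 'I_k.+2)
   [set x | (p ij.1 x <= p ij.2 x) == e ij]).
  apply: bigsetI_measurable => ij _; apply: measurable_set_pred.
  have mle : measurable_fun setT (fun x => p ij.1 x <= p ij.2 x).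
    exact: measurable_fun_ler.
  case: (e ij); first by under eq_fun do rewrite eqb_id.
  by under eq_fun do rewrite eqbF_neg; exact: measurable_neg.
rewrite -bigcap_seq; apply/seteqP; split => [x /= <- ij _ /=|x /= h].
  by rewrite ffunE.
by apply/ffunP => ij; rewrite ffunE; apply/eqP; apply: (h ij); rewrite /= mem_index_enum.
Qed.

Variable p : 'I_k.+2 -> T -> R.

Let pat x := order_pattern (p ^~ x).

Lemma le_bayes_rule j x : p j x <= p (bayes_rule p x) x.
Proof. by rewrite /bayes_rule; case: arg_maxP => //= i _; apply. Qed.

Let ranking (e : {ffun 'I_k.+2 * 'I_k.+2 -> bool}) : seq 'I_k.+2 :=
  sort (fun i j => e (j, i)) (enum 'I_k.+2).

Let size_ranking e : size (ranking e) = k.+2.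
Proof. by rewrite size_sort size_enum_ord. Qed.

Let etaE x : eta p x =
  p (nth ord0 (ranking (pat x)) 0) x - p (nth ord0 (ranking (pat x)) 1) x.
Proof.
rewrite /eta sort_map.
have -> : sort (relpre (p ^~ x) (fun a b : R => b <= a)) (enum 'I_k.+2) =
    ranking (pat x).
  by congr sort; apply/funext => i; apply/funext => j; rewrite ffunE.
by rewrite !(nth_map ord0) ?size_ranking.
Qed.

Let ranking_sorted x : sorted (fun i j => p j x <= p i x) (ranking (pat x)).
Proof.
rewrite (_ : ranking (pat x) = sort (fun i j => p j x <= p i x) (enum 'I_k.+2)).
  by apply: sort_sorted => i j; exact: le_total.
by congr sort; apply/funext => i; apply/funext => j; rewrite ffunE.
Qed.

Lemma eta_ge0 x : 0 <= eta p x.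
Proof.
rewrite etaE subr_ge0; have := ranking_sorted x; have := size_ranking (pat x).
by case: ranking => [|i [|j s]]//= _ /andP[].
Qed.

(** The first ranked class attains the Bayes value, so a class strictly below it is dominated by the
    second ranked one. Strictness matters: at the Bayes class the gap is [0] while [eta] may be
    positive. *)
Lemma eta_le_gap j x : p j x < p (bayes_rule p x) x ->
  eta p x <= p (bayes_rule p x) x - p j x.
Proof.
move=> jb; rewrite etaE; set b := bayes_rule p x in jb *.
have jr i : i \in ranking (pat x) by rewrite mem_sort mem_enum.
have := jr j; have := jr b.
have := ranking_sorted x; have := size_ranking (pat x).
case: ranking => [|i0 [|i1 s]]//= _ /andP[h01 h] bs js.
have rtrans : transitive (fun i i' => p i' x <= p i x).
  by move=> i i' i'' h1 h2; exact: le_trans h2 h1.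
have h1 i : i \in i1 :: s -> p i x <= p i1 x.
  rewrite inE => /predU1P[->//|ins].
  by have /allP := order_path_min rtrans h; exact.
have h0 i : i \in i0 :: i1 :: s -> p i x <= p i0 x.
  by rewrite inE => /predU1P[->//|/h1/le_trans]; apply.
have bi0 : p b x = p i0 x.
  by apply/eqP; rewrite eq_le h0//= le_bayes_rule.
move: js; rewrite inE => /predU1P[ji0|/h1 ji1].
  by move: jb; rewrite ji0 bi0 ltxx.
by rewrite bi0 lerB.
Qed.

Lemma measurable_bayes_rule j : (forall j, measurable_fun setT (p j)) ->
  measurable (bayes_rule p @^-1` [set j]).
Proof.
move=> mp.
(* [F] copies the unfolding of the arg max as a [pick], with the comparisons read off the
   pattern. *)
pose F (e : {ffun 'I_k.+2 * 'I_k.+2 -> bool}) : 'I_k.+2 :=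
  odflt ord0 [pick i | true & [forall (j | true), e (j, i)]].
have bE : bayes_rule p = F \o pat.
  apply/funext => x; rewrite /bayes_rule /Order.arg_max /extremum /F /=.
  by congr odflt; apply: eq_pick => i /=; apply: eq_forallb => i'; rewrite ffunE.
rewrite bE comp_preimage.
by apply: (measurable_finfiber (phi := pat)) => e; exact: measurable_order_pattern.
Qed.

Lemma measurable_eta : (forall j, measurable_fun setT (p j)) ->
  measurable_fun setT (eta p).
Proof.
move=> mp; rewrite (_ : eta p = fun x =>
  p (nth ord0 (ranking (pat x)) 0) x - p (nth ord0 (ranking (pat x)) 1) x).
  apply: (measurable_fun_finfiber
    (F := fun e x => p (nth ord0 (ranking e) 0) x - p (nth ord0 (ranking e) 1) x)).
    by move=> e; exact: measurable_order_pattern.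
  by move=> e; exact: measurable_funB.
by apply/funext => x; exact: etaE.
Qed.

End argmax.

(** * Regular points, label masses and the excess error as an integral *)

Section model.
Context {R : realType} {disp : measure_display} {Omega : measurableType disp}.
Variable P : probability Omega R.
Context {d k : nat}.
Variables (X : {RV P >-> d.-tuple R}) (Y : {RV P >-> 'I_k.+2}).
Variables (f : d.-tuple R -> R) (p : 'I_k.+2 -> d.-tuple R -> R).
Variables (kappa gamma0 nu0 : R).
Hypothesis kappa0 : 0 < kappa.
Hypothesis gamma00 : 0 < gamma0.
Hypothesis reg : regression X Y p.
Hypothesis dens : strong_density X f kappa gamma0 nu0.

Let mu := distribution P X.

(* Positivity of [f] at [x] forces [x] into the support by the ball condition, so
   that no separability argument is needed. *)
Definition regular_points : set (d.-tuple R) :=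
  [set x | (forall j, 0 <= p j x <= 1) /\ 0 < f x].

Let mp j : measurable_fun setT (p j). Proof. by have [] := reg j. Qed.

Let mf : measurable_fun setT f. Proof. by have [] := dens. Qed.

Let regE j A : measurable A ->
  P (X @^-1` A `&` Y @^-1` [set j]) = (\int[mu]_(x in A) (p j x)%:E)%E.
Proof. by have [_] := reg j; exact. Qed.

Let mXA A : measurable A -> measurable (X @^-1` A).
Proof. by move=> mA; exact: measurable_funPTI. Qed.

Let mY j : measurable (Y @^-1` [set j]).
Proof. exact: measurable_funPTI. Qed.

Let int_fin j A : measurable A -> (\int[mu]_(x in A) (p j x)%:E)%E \is a fin_num.
Proof.
by move=> mA; rewrite -regE// fin_num_measure//; apply: measurableI => //; exact: mXA.
Qed.

(** The integral of [p j] over this set is a probability, hence nonnegative, although the integrand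
    is negative there. *)
Let null_neg j : mu [set x | p j x < 0] = 0%E.
Proof.
have mA : measurable [set x | p j x < 0].
  by apply: measurable_set_pred; exact: measurable_fun_ltr.
apply: (@null_of_integral0 _ _ _ mu _ (fun x => - p j x)) => //.
- exact: measurableT_comp.
- by move=> x /=; rewrite oppr_gt0.
apply/eqP; rewrite eq_le; apply/andP; split; last first.
  by apply: integral_ge0 => x /= px; rewrite lee_fin oppr_ge0 ltW.
under eq_integral do rewrite EFinN.
have -> : (\int[mu]_(x in [set x | (p j x < 0)%R]) - (p j x)%:E =
    - \int[mu]_(x in [set x | (p j x < 0)%R]) (p j x)%:E)%E.
  have E : (\int[mu]_(x in [set x | (p j x < 0)%R]) (p j x)%:E =
      \int[mu]_(x in [set x | (p j x < 0)%R]) - (- (p j x)%:E))%E.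
    by apply: eq_integral => x _; rewrite oppeK.
  rewrite E [X in _ = (- X)%E]integral_ge0N ?oppeK// => x /= px.
  by rewrite lee_fin oppr_ge0 ltW.
by rewrite -regE// oppe_le0.
Qed.

(** The integral of [p j] over this set is at most its mass, so the positive function [p j - 1] has
    integral at most [0] there. *)
Let null_big j : mu [set x | 1 < p j x] = 0%E.
Proof.
set B := [set x | 1 < p j x].
have mB : measurable B.
  by apply: measurable_set_pred; exact: measurable_fun_ltr.
apply: (@null_of_integral0 _ _ _ mu _ (fun x => p j x - 1)) => //.
- exact: measurable_funB.
- by move=> x /=; rewrite subr_gt0.
apply/eqP; rewrite eq_le; apply/andP; split; last first.
  by apply: integral_ge0 => x /= px; rewrite lee_fin subr_ge0 ltW.
have muB : mu B \is a fin_num by rewrite fin_num_measure.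
have : (\int[mu]_(x in B) (p j x - 1)%:E + mu B <= mu B)%E.
  rewrite -[X in (_ + X <= _)%E]mul1e -integral_cst// -ge0_integralD//.
  - under eq_integral do rewrite -EFinD subrK.
    rewrite -regE//; apply: le_measure; rewrite ?inE//.
    + by apply: measurableI => //; exact: mXA.
    + exact: mXA.
  - by move=> x /= px; rewrite lee_fin subr_ge0 ltW.
  - by apply/measurable_EFinP; apply: measurable_funTS; exact: measurable_funB.
by rewrite -leeBrDr// subee.
Qed.

Let null_f : mu [set x | f x <= 0] = 0%E.
Proof.
have [_ f0 fE _ _] := dens.
rewrite [LHS]fE; last by apply: measurable_set_pred; exact: measurable_fun_ler.
apply: integral0_eq => x /= fx; congr EFin.
by apply/eqP; rewrite eq_le fx f0.
Qed.

Lemma measurable_regular_points : measurable regular_points.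
Proof.
rewrite (_ : regular_points =
  (\big[setI/setT]_(j < k.+2) [set x | (0 <= p j x) && (p j x <= 1)]) `&` [set x | 0 < f x]).
  apply: measurableI.
    apply: bigsetI_measurable => j _; apply: measurable_set_pred.
    by apply: measurable_and; exact: measurable_fun_ler.
  by apply: measurable_set_pred; exact: measurable_fun_ltr.
rewrite -bigcap_seq; apply/seteqP; split => x [h fx]; split => // j.
  by move=> _; exact: h.
by apply: (h j); rewrite /= mem_index_enum.
Qed.

Lemma regular_points_full : mu regular_points = 1%E.
Proof.
have mA := measurable_regular_points.
suff null : mu (~` regular_points) = 0%E.
  have := probability_setC mu (measurableC mA); rewrite setCK => h.
  by rewrite [LHS]h [X in (_ - X)%E]null sube0.
apply: measure_negligible; first exact: measurableC.
apply: (@negligibleS _ _ _ _ ((\big[setU/set0]_(j < k.+2)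
    ([set x | p j x < 0] `|` [set x | 1 < p j x])) `|` [set x | f x <= 0])).
  move=> x /not_andP[/existsNP[j /negP]|/negP]; last by rewrite -leNgt; right.
  rewrite negb_and -!ltNge => h; left; rewrite -bigcup_seq; exists j => /=.
    by rewrite mem_index_enum.
  by case/orP : h; [left|right].
apply: negligibleU.
  apply: big_ind => [|A B|j _]; [exact: negligible_set0|exact: negligibleU|].
  apply: negligibleU; apply/negligibleP => //.
    by apply: measurable_set_pred; exact: measurable_fun_ltr.
  by apply: measurable_set_pred; exact: measurable_fun_ltr.
apply/negligibleP => //.
by apply: measurable_set_pred; exact: measurable_fun_ler.
Qed.

Lemma regular_ball x r : regular_points x -> 0 < r <= gamma0 ->
  ((kappa * nu0 * r ^+ d)%:E <= mu (eball x r))%E.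
Proof.
move=> [_ fx] /andP[r0 rg]; have [_ _ _ ball supp] := dens.
have nu0f : nu0 <= f x.
  apply: supp => e e0.
  have e1 : 0 < Num.min e gamma0 by rewrite lt_min e0.
  apply: (@lt_le_trans _ _ (kappa * f x * Num.min e gamma0 ^+ d)%:E).
    by rewrite lte_fin !mulr_gt0// exprn_gt0.
  apply: (@le_trans _ _ (mu (eball x (Num.min e gamma0)))).
    by apply: ball; rewrite e1/= ge_min lexx orbT.
  apply: le_measure; rewrite ?inE; [exact: measurable_eball..|].
  by move=> y; rewrite /eball /= lt_min => /andP[].
apply: le_trans (ball x r _); last by rewrite r0.
by rewrite lee_fin ler_wpM2r ?exprn_ge0 ?(ltW r0)// ler_wpM2l// ltW.
Qed.

(** Irregular points form a null set, so cutting them off does not change the probability. This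
    links the integrals of the abstract cells to what the votes estimate. *)
Lemma label_massE j A : measurable A ->
  (label_mass mu p regular_points j A)%:E = P (X @^-1` A `&` Y @^-1` [set j]).
Proof.
move=> mA; have mR := measurable_regular_points.
have mAR : measurable (A `&` regular_points) by exact: measurableI.
rewrite /label_mass -regE// fineK; last first.
  by rewrite fin_num_measure//; apply: measurableI => //; exact: mXA.
have null : P (X @^-1` (~` regular_points)) = 0%E.
  have h := probability_setC mu mR.
  by rewrite [LHS]h [X in (_ - X)%E]regular_points_full -EFinB subrr.
apply/eqP; rewrite eq_le; apply/andP; split.
  apply: le_measure; rewrite ?inE; try by apply: measurableI => //; exact: mXA.
  by move=> w [[Aw _] Yw]; split.
apply: (@le_trans _ _ (P ((X @^-1` (A `&` regular_points) `&` Y @^-1` [set j]) `|`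
    X @^-1` (~` regular_points)))).
  apply: le_measure; rewrite ?inE.
  - by apply: measurableI => //; exact: mXA.
  - apply: measurableU; first by apply: measurableI => //; exact: mXA.
    by apply: mXA; exact: measurableC.
  - by move=> w [Aw Yw]; have [h|h] := pselect (regular_points (X w)); [left|right].
have m1 : measurable (X @^-1` (A `&` regular_points) `&` Y @^-1` [set j]).
  by apply: measurableI => //; exact: mXA.
by rewrite measureU0//; apply: mXA; exact: measurableC.
Qed.

Lemma sum_label_mass A : measurable A ->
  \sum_j label_mass mu p regular_points j A = fine (mu A).
Proof.
move=> mA; apply: EFin_inj; rewrite -sumEFin fineK ?fin_num_measure//.
rewrite -[RHS]/(P (X @^-1` A)) (measure_finfiber P (mXA mA) (phi := Y))//.
by apply: eq_bigr => j _; exact: label_massE.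
Qed.

(** Total probability over the label: given [Y = j] a correct answer means [g X = j], and the joint
    probability is an integral of [p j]. *)
Lemma errorE (g : d.-tuple R -> 'I_k.+2) :
  (forall j, measurable (g @^-1` [set j])) ->
  (error X Y g)%:E = (1 - \int[mu]_(x in regular_points) (p (g x) x)%:E)%E.
Proof.
move=> mg; have mR := measurable_regular_points.
have mgY : measurable [set w | g (X w) == Y w].
  rewrite (_ : [set _ | _] = \big[setU/set0]_(j < k.+2)
      (X @^-1` (g @^-1` [set j]) `&` Y @^-1` [set j])).
    by apply: bigsetU_measurable => j _; apply: measurableI => //; exact: mXA.
  rewrite -bigcup_seq; apply/seteqP; split => [w /= /eqP gw|w [j _ [/= -> ->]]//].
  by exists (Y w); rewrite //= mem_index_enum.
have -> : (\int[mu]_(x in regular_points) (p (g x) x)%:E)%E =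
    P [set w | g (X w) == Y w].
  rewrite (measure_finfiber P mgY (phi := Y))//.
  transitivity (\sum_j \int[mu]_(x in regular_points) (\1_(g @^-1` [set j]) x * p j x)%:E)%E.
    rewrite -ge0_integral_sum//; last 2 first.
    - move=> j; apply/measurable_EFinP; apply: measurable_funTS.
      by apply: measurable_funM.
    - by move=> j x [/(_ j)/andP[pj0 _] _]; rewrite lee_fin mulr_ge0.
    apply: eq_integral => x _; rewrite sumEFin; congr EFin.
    rewrite (bigD1 (g x))//= indicE mem_set// mul1r big1 ?addr0// => j /negP jg.
    by rewrite indicE memNset ?mul0r//= => e; apply: jg; rewrite e.
  apply: eq_bigr => j _.
  transitivity (P (X @^-1` (g @^-1` [set j]) `&` Y @^-1` [set j])); last first.
    congr (P _); apply/seteqP; split => [w [/= -> ->]//|w [/= /eqP e Yj]].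
    by split => //=; rewrite e.
  rewrite -label_massE// /label_mass fineK; last first.
    by apply: int_fin; exact: measurableI.
  rewrite [LHS]integral_mkcond [RHS]integral_mkcond; apply: eq_integral => x _.
  rewrite !patchE in_setI indicE; case: ifPn => xA; last by rewrite andbF.
  by rewrite andbT; case: ifPn => _; rewrite ?mul1r ?mul0r.
rewrite -probability_setC// /error fineK.
  by congr (P _); apply/seteqP; split => w /= /negP.
rewrite (_ : [set w | _] = ~` [set w | g (X w) == Y w]).
  by rewrite fin_num_measure//; exact: measurableC.
by apply/seteqP; split => w /= /negP.
Qed.

Lemma regretE (g : d.-tuple R -> 'I_k.+2) :
  (forall j, measurable (g @^-1` [set j])) ->
  (error X Y g)%:E = ((error X Y (bayes_rule p))%:E +
    \int[mu]_(x in regular_points) (p (bayes_rule p x) x - p (g x) x)%:E)%E.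
Proof.
move=> mg; have mR := measurable_regular_points.
have mb j : measurable (bayes_rule p @^-1` [set j]) by exact: measurable_bayes_rule.
have mpg (h : d.-tuple R -> 'I_k.+2) : (forall j, measurable (h @^-1` [set j])) ->
    measurable_fun setT (fun x => p (h x) x).
  by move=> mh; exact: (measurable_fun_finfiber (F := p)).
rewrite !errorE//.
have fin (h : d.-tuple R -> 'I_k.+2) : (forall j, measurable (h @^-1` [set j])) ->
    (\int[mu]_(x in regular_points) (p (h x) x)%:E)%E \is a fin_num.
  move=> mh; have := errorE mh; set I := integral _ _ _.
  by case: I.
have -> : (\int[mu]_(x in regular_points) (p (bayes_rule p x) x)%:E =
    \int[mu]_(x in regular_points) (p (g x) x)%:E +
    \int[mu]_(x in regular_points) (p (bayes_rule p x) x - p (g x) x)%:E)%E.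
  rewrite -ge0_integralD//.
  - by apply: eq_integral => x _; rewrite -EFinD addrC subrK.
  - by move=> x [/(_ (g x))/andP[]]; rewrite lee_fin.
  - by apply/measurable_EFinP; apply: measurable_funTS; exact: mpg.
  - by move=> x _; rewrite lee_fin subr_ge0 le_bayes_rule.
  - apply/measurable_EFinP; apply: measurable_funTS; apply: measurable_funB; exact: mpg.
set D := (\int[mu]_(x in regular_points)
  (p (bayes_rule p x) x - p (g x) x)%:E)%E.
have Dfin : D \is a fin_num.
  rewrite ge0_fin_numE; last first.
    by apply: integral_ge0 => x _; rewrite lee_fin subr_ge0 le_bayes_rule.
  apply: (@le_lt_trans _ _ (\int[mu]_(x in regular_points) (p (bayes_rule p x) x)%:E)%E).
    apply: ge0_le_integral => //.
    - by move=> x _; rewrite lee_fin subr_ge0 le_bayes_rule.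
    - by apply/measurable_EFinP; apply: measurable_funTS; apply: measurable_funB; exact: mpg.
    - by apply/measurable_EFinP; apply: measurable_funTS; exact: mpg.
    - by move=> x [/(_ (g x))/andP[pg _] _]; rewrite lee_fin gerBl.
  by have := fin _ mb; rewrite fin_numE => /andP[_]; rewrite ltey.
rewrite oppeD; last by rewrite fin_num_adde_defl.
by rewrite -addeA subeK.
Qed.

End model.

(** * Measurability of the classifier *)

Section optinet_measurable.
Context {R : realType} {d k n m : nat} {dT : measure_display} {T : measurableType dT}.

Lemma measurable_ffun_fiber (I J : finType) (phi : T -> I -> J) c :
  (forall i j, measurable [set t | phi t i = j]) ->
  measurable [set t | [ffun i => phi t i] = c].
Proof.
move=> mphi; rewrite (_ : [set _ | _] = \big[setI/setT]_i [set t | phi t i = c i]).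
  by apply: bigsetI_measurable => i _; exact: mphi.
rewrite -bigcap_seq; apply/seteqP; split => [t /= <- i _|t /= h].
  by rewrite /= ffunE.
by apply/ffunP => i; rewrite ffunE; apply: (h i); rewrite /= mem_index_enum.
Qed.

Lemma measurable_pair_fiber (I J : finType) (phi : T -> I) (psi : T -> J) c :
  (forall i, measurable [set t | phi t = i]) ->
  (forall j, measurable [set t | psi t = j]) ->
  measurable [set t | (phi t, psi t) = c].
Proof.
move=> mphi mpsi; rewrite (_ : [set _ | _] = [set t | phi t = c.1] `&` [set t | psi t = c.2]).
  exact: measurableI.
by apply/seteqP; split => [t /= <-//|t [/= -> ->]]; case: c.
Qed.

Lemma measurable_bool_fiber (b : T -> bool) c :
  measurable_fun setT b -> measurable [set t | b t = c].
Proof.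
move=> mb; have -> : [set t | b t = c] = setT `&` b @^-1` [set c] by rewrite setTI.
exact: mb.
Qed.

(** A cell's vote sees a labeled point only through its membership and its label. Factoring through
    this finite code reduces measurability to finitely many fibres. *)
Definition label_of (tau : {set 'I_k.+2} -> 'I_k.+2)
    (c : {ffun 'I_n -> bool * 'I_k.+2}) : 'I_k.+2 :=
  tau [set j | [forall j' : 'I_k.+2,
    (\sum_i (((c i).2 == j') && (c i).1) <= \sum_i (((c i).2 == j) && (c i).1))%N]]%SET.

Lemma net_labelE (xu : m.-tuple (d.-tuple R)) N tau (xs : 'I_n -> d.-tuple R) ys l :
  net_label xu N tau xs ys l = label_of tau [ffun i => (voronoi xu N l (xs i), ys i)].
Proof.
congr tau; apply/setP => j; rewrite !inE; apply: eq_forallb => j'.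
by congr (_ <= _)%N; apply: eq_bigr => i _; rewrite ffunE.
Qed.

Variables (xu : T -> m.-tuple (d.-tuple R)) (xs : 'I_n -> T -> d.-tuple R).
Variables (ys : 'I_n -> T -> 'I_k.+2) (x : T -> d.-tuple R).
Variable tau : {set 'I_k.+2} -> 'I_k.+2.
Hypothesis mxu : measurable_fun setT xu.
Hypothesis mxs : forall i, measurable_fun setT (xs i).
Hypothesis mys : forall i, measurable_fun setT (ys i).
Hypothesis mx : measurable_fun setT x.

Lemma measurable_net_label N l j :
  measurable [set t | net_label (xu t) N tau (xs ^~ t) (ys ^~ t) l = j].
Proof.
rewrite (_ : [set _ | _] =
    (fun t => [ffun i => (voronoi (xu t) N l (xs i t), ys i t)]) @^-1`
      [set c | label_of tau c = j]).
  apply: measurable_finfiber => c; apply: measurable_ffun_fiber => i c'.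
  apply: measurable_pair_fiber => b.
    by apply: measurable_bool_fiber; exact: measurable_voronoi.
  rewrite -[X in measurable X](setTI (ys i @^-1` [set b])); exact: mys.
by apply/seteqP; split => t /=; rewrite net_labelE.
Qed.

Lemma measurable_optinet N j :
  measurable [set t | optinet (xu t) N tau (xs ^~ t) (ys ^~ t) (x t) = j].
Proof.
pose F (c : {ffun 'I_m -> bool} * {ffun 'I_m -> 'I_k.+2}) :=
  if [pick l | c.1 l] is Some l then c.2 l else ord0.
rewrite (_ : [set _ | _] =
    (fun t => ([ffun l => voronoi (xu t) N l (x t)],
               [ffun l => net_label (xu t) N tau (xs ^~ t) (ys ^~ t) l])) @^-1`
      [set c | F c = j]).
  apply: measurable_finfiber => c; apply: measurable_pair_fiber => a.
    apply: measurable_ffun_fiber => i b; apply: measurable_bool_fiber.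
    exact: measurable_voronoi.
  by apply: measurable_ffun_fiber => i b; exact: measurable_net_label.
suff E t : optinet (xu t) N tau (xs ^~ t) (ys ^~ t) (x t) =
   F ([ffun l => voronoi (xu t) N l (x t)],
      [ffun l => net_label (xu t) N tau (xs ^~ t) (ys ^~ t) l]).
  by apply/seteqP; split => t /=; rewrite E.
rewrite /optinet /F /=; under [in RHS]eq_pick do rewrite ffunE.
by case: pickP => // l _; rewrite ffunE.
Qed.

Lemma measurable_optinet_net (net : m.-tuple (d.-tuple R) -> {set 'I_m}) j :
  (forall N, measurable (net @^-1` [set N])) ->
  measurable [set t | optinet (xu t) (net (xu t)) tau (xs ^~ t) (ys ^~ t) (x t) = j].
Proof.
move=> mnet.
rewrite (_ : [set _ | _] = \big[setU/set0]_(N : {set 'I_m})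
    ((xu @^-1` (net @^-1` [set N])) `&`
     [set t | optinet (xu t) N tau (xs ^~ t) (ys ^~ t) (x t) = j])).
  apply: bigsetU_measurable => N _; apply: measurableI; last exact: measurable_optinet.
  rewrite -[X in measurable X]setTI; exact: mxu.
rewrite -bigcup_seq; apply/seteqP; split => [t /= tj|t [N _ [/= -> ]]//].
by exists (net (xu t)); rewrite //= mem_index_enum.
Qed.

End optinet_measurable.

(** * Expected excess error for a fixed unlabeled sample *)

Section fixed_net.
Context {R : realType} {disp : measure_display} {Omega : measurableType disp}.
Variable P : probability Omega R.
Context {d k n m : nat}.
Variables (X : {RV P >-> d.-tuple R}) (Y : {RV P >-> 'I_k.+2}).
Variables (f : d.-tuple R -> R) (p : 'I_k.+2 -> d.-tuple R -> R).
Variables (kappa gamma0 nu0 C beta : R).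
Hypothesis kappa0 : 0 < kappa.
Hypothesis gamma00 : 0 < gamma0.
Hypothesis nu00 : 0 < nu0.
Hypothesis C0 : 0 < C.
Hypothesis beta0 : 0 < beta.
Hypothesis reg : regression X Y p.
Hypothesis dens : strong_density X f kappa gamma0 nu0.
Hypothesis hoel : hoelder_condition p C beta.

Variables (Xs : 'I_n -> {RV P >-> d.-tuple R}) (Ys : 'I_n -> {RV P >-> 'I_k.+2}).
Variable tau : {set 'I_k.+2} -> 'I_k.+2.
Hypothesis tauP : tie_breaking tau.

Let mZ (X' : {RV P >-> d.-tuple R}) (Y' : {RV P >-> 'I_k.+2}) :
  measurable_fun setT (fun w => (X' w, Y' w)).
Proof. exact: measurable_fun_pair. Qed.

Hypothesis Zlaw : forall i, same_law P (fun w => (Xs i w, Ys i w)) (fun w => (X w, Y w)).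
Hypothesis Zindep : forall B : 'I_n -> set (d.-tuple R * 'I_k.+2),
  (forall i, measurable (B i)) ->
  P (\big[setI/setT]_(i < n) ((fun w => (Xs i w, Ys i w)) @^-1` B i)) =
    (\prod_(i < n) P ((fun w => (Xs i w, Ys i w)) @^-1` B i))%E.

Variables (u : m.-tuple (d.-tuple R)) (N : {set 'I_m}) (gamma : R).
Hypothesis gamma_gt0 : 0 < gamma.
Hypothesis gamma_le : gamma <= gamma0.
Hypothesis netN : gamma_net gamma u N.
Hypothesis u_reg : forall j, regular_points f p (tnth u j).

Let mu := distribution P X.
Let A0 := regular_points f p.

Definition cell l := [set x | voronoi u N l x].

Definition near_sample := [set x | exists j, edist x (tnth u j) < gamma].

(** This instantiates [lambda]. As [u] is frozen, it is the conditional law of the label of cell [l]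
    given the unlabeled sample. *)
Definition label_prob l j :=
  fine (P [set w | net_label u N tau (Xs ^~ w) (Ys ^~ w) l = j]).

Lemma measurable_cell l : measurable (cell l).
Proof.
apply: measurable_set_pred.
by apply: (measurable_voronoi N l (f := cst u) (g := id)).
Qed.

Lemma measurable_near_sample : measurable near_sample.
Proof.
rewrite (_ : near_sample = \big[setU/set0]_(j < m) [set x | edist x (tnth u j) < gamma]).
  apply: bigsetU_measurable => j _; apply: measurable_set_pred.
  by apply: measurable_fun_ltr => //; exact: measurable_edist.
rewrite -bigcup_seq; apply/seteqP; split => [x [j xj]|x [j _ xj]]; last by exists j.
by exists j; rewrite //= mem_index_enum.
Qed.

Let mlab l j : measurable [set w | net_label u N tau (Xs ^~ w) (Ys ^~ w) l = j].
Proof. by apply: (@measurable_net_label _ _ _ _ _ _ _ (cst u) Xs Ys). Qed.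

Lemma label_prob_ge0 l j : 0 <= label_prob l j.
Proof. exact: fine_ge0. Qed.

Lemma sum_label_prob l : \sum_j label_prob l j = 1.
Proof.
apply: EFin_inj; rewrite -sumEFin -(probability_setT P).
rewrite (measure_finfiber P measurableT
  (phi := fun w => net_label u N tau (Xs ^~ w) (Ys ^~ w) l))//; last first.
  by move=> j; exact: mlab.
by apply: eq_bigr => j _; rewrite setTI fineK// fin_num_measure//; exact: mlab.
Qed.

Lemma net_label_votes (xs : 'I_n -> d.-tuple R) (ys : 'I_n -> 'I_k.+2) l j j' :
  net_label u N tau xs ys l = j ->
  (votes u N xs ys l j' <= votes u N xs ys l j)%N.
Proof.
move=> <-; rewrite /net_label; set A := [set _ | _]%SET.
suff /tauP : A != finset.set0 by rewrite inE => /forallP.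
case: (@arg_maxnP _ ord0 predT (fun j => votes u N xs ys l j) isT) => i _ imax.
by apply/set0Pn; exists i; rewrite inE; apply/forallP => i'; exact: imax.
Qed.

(** Each point of the cell scores [1] for the label [j'] and [-1] for [j]. The score vanishes
    outside the cell, so its second moment is at most the cell mass, and [j] can win only if the
    total score is nonpositive. *)
Lemma label_prob_tail l j j' D : 0 <= D <= fine (mu (cell l)) ->
  D <= label_mass mu p A0 j' (cell l) - label_mass mu p A0 j (cell l) ->
  0 < fine (mu (cell l)) ->
  label_prob l j <= expR (- (n%:R * (D ^+ 2 / (8 * fine (mu (cell l)))))).
Proof.
move=> Dv Djj v0.
pose Z0 : {RV P >-> (d.-tuple R * 'I_k.+2)%type} := mfun_Sub (mem_set (mZ X Y)).
pose Z i : {RV P >-> (d.-tuple R * 'I_k.+2)%type} := mfun_Sub (mem_set (mZ (Xs i) (Ys i))).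
pose phi (z : d.-tuple R * 'I_k.+2) : bool * 'I_k.+2 := (voronoi u N l z.1, z.2).
pose h (t : bool * 'I_k.+2) : R := (t.1 && (t.2 == j'))%:R - (t.1 && (t.2 == j))%:R.
have mphi t : measurable (phi @^-1` [set t]).
  apply: measurable_pair_fiber => c.
    apply: measurable_bool_fiber.
    by apply: (measurable_voronoi N l (f := cst u) (g := fst)).
  by rewrite -[X in measurable X](setTI (snd @^-1` [set c])); exact: measurable_snd.
have QE t : P (Z0 @^-1` (phi @^-1` [set t])) =
    P (X @^-1` [set x | voronoi u N l x = t.1] `&` Y @^-1` [set t.2]).
  case: t => a i; congr (P _).
  by apply/seteqP; split => [w [<- <-]//|w [/= <- <-]].
have Qt i : fine (P (Z0 @^-1` (phi @^-1` [set (true, i)]))) =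
    label_mass mu p A0 i (cell l).
  rewrite QE; apply: EFin_inj; rewrite (label_massE reg dens)//; last exact: measurable_cell.
  rewrite fineK// fin_num_measure//; apply: measurableI.
    by apply: measurable_funPTI; exact: measurable_cell.
  exact: measurable_funPTI.
have sumQ (F : bool * 'I_k.+2 -> R) : (forall i, F (false, i) = 0) ->
    \sum_t F t = \sum_i F (true, i).
  move=> F0; transitivity (\sum_(c : bool) \sum_(i < k.+2) F (c, i)).
    by rewrite pair_bigA; apply: eq_bigr => -[].
  by rewrite big_bool /= [X in _ + X]big1 ?addr0// => i _; exact: F0.
have := @vote_prob _ _ _ P _ _ n Z0 Z Zlaw Zindep _ phi h
  (fine (mu (cell l))) D mphi.
have h1 t : `|h t| <= 1.
  by rewrite /h; case: (_ && _); case: (_ && _);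
    rewrite /= ?subrr ?subr0 ?sub0r ?normrN ?normr0 ?normr1.
move=> /(_ h1 Dv v0) /=; rewrite !sumQ; last 2 first.
- by move=> i; rewrite /h/= subrr expr0n mulr0.
- by move=> i; rewrite /h/= subrr mulr0.
have -> : \sum_i fine (P (Z0 @^-1` (phi @^-1` [set (true, i)]))) * h (true, i) =
    label_mass mu p A0 j' (cell l) - label_mass mu p A0 j (cell l).
  under eq_bigr => i _ do rewrite Qt /h/= mulrBr.
  rewrite sumrB; congr (_ - _).
    rewrite (bigD1 j')//= eqxx mulr1 big1 ?addr0// => i /negPf ->.
    by rewrite mulr0.
  rewrite (bigD1 j)//= eqxx mulr1 big1 ?addr0// => i /negPf ->.
  by rewrite mulr0.
move=> /(_ Djj) hh.
have : (P [set w | (\sum_(i < n) h (phi (Z i w)) <= 0)%R] <=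
    (expR (- (n%:R * (D ^+ 2 / (8 * fine (mu (cell l)))))))%:E)%E.
  apply: hh.
  rewrite -(sum_label_mass reg dens (measurable_cell l)).
  apply: ler_sum => i _; rewrite Qt ler_piMr ?label_mass_ge0//.
    by move=> i' x [].
  have := h1 (true, i); rewrite ler_norml => /andP[? ?]; nra.
move=> tailP; rewrite -lee_fin fineK; last by rewrite fin_num_measure//; exact: mlab.
apply: le_trans tailP; apply: le_measure; rewrite ?inE.
- exact: mlab.
- apply: measurable_set_pred; apply: measurable_fun_ler => //.
  apply: measurable_sum => i.
  apply: (measurable_fun_finfiber (phi := phi \o Z i) (F := fun t _ => h t)) => // t.
  by rewrite comp_preimage; apply: measurable_funPTI.
move=> w /= lj; have := net_label_votes j' lj.
have vE i : (votes u N (Xs ^~ w) (Ys ^~ w) l i)%:R =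
    \sum_(a < n) ((voronoi u N l (Xs a w)) && (Ys a w == i))%:R :> R.
  by rewrite /votes natr_sum; apply: eq_bigr => a _; rewrite andbC.
by rewrite -(ler_nat R) !vE -subr_le0 -sumrB.
Qed.

Definition cell_mass_bound := kappa * nu0 * (gamma / 2) ^+ d.

Lemma cell_mass_bound_gt0 : 0 < cell_mass_bound.
Proof. by rewrite !mulr_gt0// exprn_gt0// divr_gt0. Qed.

(** A nonempty cell has its centre in the net, hence a regular point. The ball of radius [gamma / 2]
    about it lies in the cell and, the centre being a sample point, in [near_sample]. *)
Lemma cell_mass_ge l : cell l !=set0 ->
  cell_mass_bound <= fine (mu (cell l `&` near_sample)).
Proof.
move=> [x /voronoi_in lN].
have [sep _] := maxsetP netN.
have mI : measurable (cell l `&` near_sample).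
  by apply: measurableI; [exact: measurable_cell|exact: measurable_near_sample].
rewrite -lee_fin fineK; last by rewrite fin_num_measure.
apply: (@le_trans _ _ (mu (eball (tnth u l) (gamma / 2)))).
  apply: (regular_ball kappa0 gamma00 dens (u_reg l)).
  by have := gamma_gt0; have := gamma_le; rewrite divr_gt0//=; lra.
apply: le_measure; rewrite ?inE//; first exact: measurable_eball.
move=> y; rewrite /eball/= edistC => yl; split; first exact: (voronoi_half_ball sep lN).
by exists l; apply: lt_trans yl _; have := gamma_gt0; lra.
Qed.

Definition cell_osc := C * (4 * gamma) `^ beta.

Lemma cell_osc_ge0 : 0 <= cell_osc.
Proof. by rewrite mulr_ge0 ?powR_ge0// ltW. Qed.

Lemma cell_oscP l j x x' : cell l x -> near_sample x -> cell l x' ->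
  near_sample x' -> p j x <= p j x' + cell_osc.
Proof.
move=> xl [i xi] x'l [i' x'i'].
have h1 := voronoi_near gamma_gt0 netN xl xi.
have h2 := voronoi_near gamma_gt0 netN x'l x'i'.
have := hoel j x x'; have := edist_triangle (tnth u l) x x'.
rewrite (edistC (tnth u l) x') => h3 h4.
rewrite -lerBlDl; apply: (le_trans (ler_norm _)); apply: (le_trans h4).
rewrite ler_wpM2l ?(ltW C0)// ge0_ler_powR ?nnegrE ?edist_ge0 ?(ltW beta0)//.
- by rewrite mulr_ge0// ltW.
- by lra.
Qed.

Let mp j : measurable_fun setT (p j). Proof. by have [] := reg j. Qed.

Let mA0 : measurable A0.
Proof. exact: (measurable_regular_points reg dens). Qed.

Let p01 j x : A0 x -> 0 <= p j x <= 1. Proof. by case. Qed.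

Let cell_uniq l l' x : cell l x -> cell l' x -> l = l'.
Proof. exact: voronoi_uniq. Qed.

Let mbayes j : measurable (bayes_rule p @^-1` [set j]).
Proof. exact: measurable_bayes_rule. Qed.

Let tail l j j' D : cell l !=set0 -> 0 <= D <= fine (mu (cell l)) ->
  D <= label_mass mu p A0 j' (cell l) - label_mass mu p A0 j (cell l) ->
  label_prob l j <= expR (- (n%:R * (D ^+ 2 / (8 * fine (mu (cell l)))))).
Proof.
move=> cl Dv Djj; apply: (label_prob_tail Dv Djj).
apply: lt_le_trans cell_mass_bound_gt0 _; apply: (le_trans (cell_mass_ge cl)).
apply: fine_le; rewrite ?fin_num_measure//.
- by apply: measurableI; [exact: measurable_cell|exact: measurable_near_sample].
- exact: measurable_cell.
apply: le_measure; rewrite ?inE.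
- by apply: measurableI; [exact: measurable_cell|exact: measurable_near_sample].
- exact: measurable_cell.
- exact: subIsetl.
Qed.

Lemma net_regret_crude :
  (\int[mu]_(x in A0) (cell_regret p cell (bayes_rule p) label_prob x)%:E <=
    (1 - (2 * k.+2%:R)^-1 +
      k.+2%:R * expR (- (n%:R * cell_mass_bound / (32 * k.+2%:R ^+ 2))))%:E)%E.
Proof.
apply: (@cell_regret_crude _ _ _ mu _ _ p A0 mp mA0 (regular_points_full reg dens) p01
  cell near_sample measurable_cell measurable_near_sample cell_uniq
  (bayes_rule p) label_prob mbayes) => //.
- exact: le_bayes_rule.
- exact: label_prob_ge0.
- exact: sum_label_prob.
- exact: cell_mass_bound_gt0.
- exact: cell_mass_ge.
- by move=> l; apply: (sum_label_mass reg dens); exact: measurable_cell.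
Qed.

Lemma net_regret_main s : 0 < s -> n%:R * cell_mass_bound * s ^+ 2 = 8 ^+ 3 ->
  (\int[mu]_(x in A0) (cell_regret p cell (bayes_rule p) label_prob x)%:E <=
    (4 * cell_osc)%:E * mu [set x | (eta p x <= 4 * cell_osc)%R] +
    (5 * fine (mu (~` near_sample)))%:E +
    (k.+2%:R * s)%:E * \int[mu]_x (expR (- (eta p x ^+ 2 / (2 * s ^+ 2))))%:E)%E.
Proof.
move=> s0 sE.
apply: (@cell_regret_main _ _ _ mu _ _ p A0 mp mA0 (regular_points_full reg dens) p01
  cell near_sample measurable_cell measurable_near_sample cell_uniq
  (bayes_rule p) label_prob mbayes _ _ _ n%:R _ _ cell_mass_bound) => //.
- exact: le_bayes_rule.
- exact: label_prob_ge0.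
- exact: sum_label_prob.
- exact: cell_mass_bound_gt0.
- exact: cell_mass_ge.
- exact: measurable_eta.
- exact: eta_ge0.
- by move=> j x; rewrite subr_gt0; exact: eta_le_gap.
- exact: cell_osc_ge0.
- exact: cell_oscP.
Qed.

Hypothesis m_gt0 : (0 < m)%N.

Let gap j x := p (bayes_rule p x) x - p j x.

Let gap0 j x : 0 <= gap j x. Proof. by rewrite subr_ge0 le_bayes_rule. Qed.

Let mgap j : measurable_fun setT (gap j).
Proof.
by apply: measurable_funB => //; exact: (measurable_fun_finfiber (F := p)).
Qed.

(** With [u] frozen only finitely many labellings occur, so the expectation passes through a double
    sum over cells and labels. As [m > 0] the cells cover the space and the default of [optinet] is
    never reached. *)
Lemma net_regretE :
  (\int[P]_w \int[mu]_(x in A0)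
     (p (bayes_rule p x) x - p (optinet u N tau (Xs ^~ w) (Ys ^~ w) x) x)%:E =
   \int[mu]_(x in A0) (cell_regret p cell (bayes_rule p) label_prob x)%:E)%E.
Proof.
pose lab l w := net_label u N tau (Xs ^~ w) (Ys ^~ w) l.
pose I l j := (\int[mu]_(x in A0) (\1_(cell l) x * gap j x)%:E)%E.
have I0 l j : (0 <= I l j)%E.
  by apply: integral_ge0 => x _; rewrite lee_fin mulr_ge0.
have mcg l j : measurable_fun A0 (fun x => (\1_(cell l) x * gap j x)%:E).
  apply/measurable_EFinP; apply: measurable_funTS; apply: measurable_funM => //.
  by apply: measurable_indic; exact: measurable_cell.
have E w x : p (bayes_rule p x) x - p (optinet u N tau (Xs ^~ w) (Ys ^~ w) x) x =
    \sum_l \sum_j \1_[set w | lab l w = j] w * (\1_(cell l) x * gap j x).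
  have [l xl] := voronoi_ex u x (gamma_net_neq0 gamma_gt0 m_gt0 netN).
  have -> : optinet u N tau (Xs ^~ w) (Ys ^~ w) x = lab l w.
    rewrite /optinet; case: pickP => [l' xl'|/(_ l)]; last by rewrite xl.
    by rewrite (voronoi_uniq xl' xl).
  rewrite (bigD1 l)//= [X in _ = _ + X]big1 ?addr0; last first.
    move=> i il; rewrite big1// => j _; rewrite [\1_(cell i) x]indicE memNset ?mul0r ?mulr0// => xi.
    by move: il; rewrite (voronoi_uniq xi xl) eqxx.
  rewrite (bigD1 (lab l w))//= [X in _ = _ + X]big1 ?addr0; last first.
    move=> j jl; rewrite indicE memNset ?mul0r//= => lj.
    by move: jl; rewrite -lj eqxx.
  by rewrite !indicE !mem_set// !mul1r.
transitivity (\int[P]_w (\sum_l \sum_j (\1_[set w | lab l w = j] w)%:E * I l j))%E.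
  apply: eq_integral => w _.
  under eq_integral do rewrite E -sumEFin.
  rewrite ge0_integral_sum//; last 2 first.
  - move=> l; under eq_fun do rewrite -sumEFin; apply: emeasurable_sum => j.
    by under eq_fun do rewrite EFinM; apply: measurable_funeM.
  - move=> l x _; rewrite lee_fin; apply: sumr_ge0 => j _.
    by rewrite !mulr_ge0.
  apply: eq_bigr => l _; under eq_integral do rewrite -sumEFin.
  rewrite ge0_integral_sum//; last 2 first.
  - by move=> j; under eq_fun do rewrite EFinM; apply: measurable_funeM.
  - by move=> j x _; rewrite lee_fin !mulr_ge0.
  apply: eq_bigr => j _; under eq_integral do rewrite EFinM.
  by rewrite ge0_integralZl// => x _; rewrite lee_fin mulr_ge0.
have mlI l j : measurable_fun setT (fun w => (\1_[set w | lab l w = j] w)%:E * I l j)%E.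
  apply: emeasurable_funM => //; apply/measurable_EFinP; apply: measurable_indic.
  exact: mlab.
rewrite ge0_integral_sum//; last 2 first.
- by move=> l; exact: emeasurable_sum.
- by move=> l w _; apply: sume_ge0 => j _; apply: mule_ge0 => //; rewrite lee_fin.
rewrite /cell_regret; under [RHS]eq_integral do rewrite -sumEFin.
rewrite [RHS]ge0_integral_sum//; last 2 first.
- move=> l; under eq_fun do rewrite -sumEFin; apply: emeasurable_sum => j.
  under eq_fun do rewrite mulrCA EFinM.
  by apply: measurable_funeM; exact: mcg.
- move=> l x _; rewrite lee_fin; apply: sumr_ge0 => j _.
  by rewrite !mulr_ge0 ?label_prob_ge0//; exact: gap0.
apply: eq_bigr => l _.
rewrite ge0_integral_sum//; last first.
  by move=> j w _; apply: mule_ge0 => //; rewrite lee_fin.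
under [RHS]eq_integral do rewrite -sumEFin.
rewrite [RHS]ge0_integral_sum//; last 2 first.
- move=> j; under eq_fun do rewrite mulrCA EFinM.
  by apply: measurable_funeM; exact: mcg.
- by move=> j x _; rewrite lee_fin !mulr_ge0 ?label_prob_ge0//; exact: gap0.
apply: eq_bigr => j _; under [RHS]eq_integral do rewrite mulrCA EFinM.
rewrite [RHS]ge0_integralZl//; last 3 first.
- exact: mcg.
- by move=> x _; rewrite lee_fin mulr_ge0//; exact: gap0.
- by rewrite lee_fin label_prob_ge0.
rewrite ge0_integralZr//; last first.
  by apply/measurable_EFinP; apply: measurable_indic; exact: mlab.
rewrite integral_indic//; last exact: mlab.
rewrite setIT.
by rewrite fineK// fin_num_measure//; exact: mlab.
Qed.

End fixed_net.

(** * Averaging over the unlabeled sample *)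

Section samples.
Context {R : realType} {disp : measure_display} {Omega : measurableType disp}.
Variable P : probability Omega R.
Context {d k n m : nat}.
Variables (X : {RV P >-> d.-tuple R}) (Y : {RV P >-> 'I_k.+2}).
Variables (Xs : 'I_n -> {RV P >-> d.-tuple R}) (Ys : 'I_n -> {RV P >-> 'I_k.+2}).
Variable Xu : 'I_m -> {RV P >-> d.-tuple R}.
Hypothesis samples : optinet_samples X Y Xs Ys Xu.

Let Z i w := (Xs i w, Ys i w).

Let big_option (S : Type) (idx : S) (op : Monoid.com_law idx) (I : finType)
    (F : option I -> S) :
  \big[op/idx]_(l in [set: option I]%SET) F l = op (F None) (\big[op/idx]_i F (Some i)).
Proof.
rewrite (bigD1 None) ?finset.in_setT//=; congr (op _ _).
rewrite (reindex_omap Some id); last by move=> [i|//]; rewrite ?andbF.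
by apply: eq_bigl => i; rewrite finset.in_setT eqxx.
Qed.

Lemma samples_indep (B : 'I_n -> set (d.-tuple R * 'I_k.+2))
    (C : 'I_m -> set (d.-tuple R)) :
  (forall i, measurable (B i)) -> (forall j, measurable (C j)) ->
  P (\big[setI/setT]_(i < n) (Z i @^-1` B i) `&`
     \big[setI/setT]_(j < m) (Xu j @^-1` C j)) =
  (\prod_(i < n) P (Z i @^-1` B i) * \prod_(j < m) P (Xu j @^-1` C j))%E.
Proof.
move=> mB mC; have [_ _ indep] := samples.
(* The pair [(X, Y)] is left unconstrained by giving its index the full event. *)
pose E (l : option ('I_n + 'I_m)) : set Omega := match l with
  | None => setT
  | Some (inl i) => Z i @^-1` B i
  | Some (inr j) => Xu j @^-1` C j
  end.
have := indep [set: option ('I_n + 'I_m)]%SET E; rewrite !big_option.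
rewrite !(big_sumType _ (fun _ => true))/=.
rewrite setTI => ->; last first.
  move=> [[i|j]|] /=.
  - by exists (B i) => //; rewrite setTI.
  - by exists (C j) => //; rewrite setTI.
  - by exists setT => //; rewrite setTI preimage_setT.
by rewrite probability_setT mul1e.
Qed.

Let bigI_setT (S : finType) : \big[setI/setT]_(i : S) (setT : set Omega) = setT.
Proof. by rewrite big1. Qed.

Lemma labeled_indep (B : 'I_n -> set (d.-tuple R * 'I_k.+2)) :
  (forall i, measurable (B i)) ->
  P (\big[setI/setT]_(i < n) (Z i @^-1` B i)) = (\prod_(i < n) P (Z i @^-1` B i))%E.
Proof.
move=> mB; have := @samples_indep B (fun=> setT) mB (fun=> measurableT).
under [in X in P (_ `&` X)]eq_bigr do rewrite preimage_setT.
rewrite bigI_setT setIT => ->.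
by rewrite [X in (_ * X)%E]big1 ?mule1// => j _; rewrite preimage_setT probability_setT.
Qed.

Lemma unlabeled_indep (C : 'I_m -> set (d.-tuple R)) :
  (forall j, measurable (C j)) ->
  P (\big[setI/setT]_(j < m) (Xu j @^-1` C j)) = (\prod_(j < m) P (Xu j @^-1` C j))%E.
Proof.
move=> mC; have := @samples_indep (fun=> setT) C (fun=> measurableT) mC.
under [in X in P (X `&` _)]eq_bigr do rewrite preimage_setT.
rewrite bigI_setT setTI => ->.
by rewrite [X in (X * _)%E]big1 ?mul1e// => j _; rewrite preimage_setT probability_setT.
Qed.

Lemma measurable_unlabeled : measurable_fun setT (fun w => [tuple Xu j w | j < m]).
Proof.
apply/measurable_fun_tnthP => j.
rewrite (_ : _ \o _ = Xu j)//; apply/funext => w /=; exact: tnth_mktuple.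
Qed.

Lemma measurable_labeled : measurable_fun setT (fun w => [tuple Z i w | i < n]).
Proof.
apply/measurable_fun_tnthP => i.
rewrite (_ : _ \o _ = Z i); first exact: measurable_fun_pair.
apply/funext => w /=; exact: tnth_mktuple.
Qed.

Definition unlabeled : {RV P >-> m.-tuple (d.-tuple R)} :=
  mfun_Sub (mem_set measurable_unlabeled).

Definition labeled : {RV P >-> n.-tuple (d.-tuple R * 'I_k.+2)} :=
  mfun_Sub (mem_set measurable_labeled).

Let unlabeled_box C : unlabeled @^-1` tuple_box C = \big[setI/setT]_(j < m) (Xu j @^-1` C j).
Proof.
rewrite -bigcap_seq; apply/seteqP; split => [w Cw j _|w Cw j].
  by have := Cw j; rewrite tnth_mktuple.
by rewrite tnth_mktuple; apply: (Cw j); rewrite /= mem_index_enum.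
Qed.

Let labeled_box B : labeled @^-1` tuple_box B = \big[setI/setT]_(i < n) (Z i @^-1` B i).
Proof.
rewrite -bigcap_seq; apply/seteqP; split => [w Cw j _|w Cw j].
  by have := Cw j; rewrite tnth_mktuple.
by rewrite tnth_mktuple; apply: (Cw j); rewrite /= mem_index_enum.
Qed.

Lemma unlabeled_labeled_indep A B : measurable A -> measurable B ->
  P (unlabeled @^-1` A `&` labeled @^-1` B) =
    (P (unlabeled @^-1` A) * P (labeled @^-1` B))%E.
Proof.
move=> mA mB; apply: indep_tuples => // C D mC mD.
rewrite unlabeled_box labeled_box setIC samples_indep// muleC.
by rewrite unlabeled_indep// labeled_indep.
Qed.

Let Xu_law j A : measurable A -> P (Xu j @^-1` A) = distribution P X A.
Proof. by have [_ law _] := samples; exact: law. Qed.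

(** The bounds for a frozen sample assume that all its points are regular; this makes the remaining
    samples negligible. *)
Lemma unlabeled_almost_in A : measurable A -> distribution P X A = 1%E ->
  distribution P unlabeled (~` tuple_box (fun=> A)) = 0%E.
Proof.
move=> mA A1; have mbox : measurable (tuple_box (fun=> A) : set (m.-tuple (d.-tuple R))).
  by rewrite tuple_boxE; apply: bigsetI_measurable => i _;
     rewrite -[X in measurable X]setTI; exact: measurable_tnth.
have h := probability_setC (distribution P unlabeled) mbox.
have h1 : distribution P unlabeled (tuple_box (fun=> A)) = 1%E.
  rewrite -[LHS]/(P (unlabeled @^-1` tuple_box (fun=> A))) unlabeled_box.
  by rewrite unlabeled_indep// big1// => j _; rewrite Xu_law.
by rewrite [LHS]h [X in (_ - X)%E]h1 subee.
Qed.

Let mfar gamma : measurable [set z : m.-tuple (d.-tuple R) * d.-tuple R |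
   (~` near_sample z.1 gamma) z.2].
Proof.
rewrite (_ : [set z | _] = \big[setI/setT]_(j < m)
    [set z : m.-tuple (d.-tuple R) * d.-tuple R | gamma <= edist z.2 (tnth z.1 j)]).
  apply: bigsetI_measurable => j _; apply: measurable_set_pred.
  apply: measurable_fun_ler => //; apply: measurable_edist => //.
  by apply: (measurableT_comp (measurable_tnth j)).
rewrite -bigcap_seq; apply/seteqP; split => [z /= h j _|z /= h [j]].
  by rewrite /= leNgt; apply/negP => zj; apply: h; exists j.
by rewrite ltNge (h j)//= mem_index_enum.
Qed.

Lemma measurable_far_mass gamma : measurable_fun setT
  (fun u : m.-tuple (d.-tuple R) => distribution P X (~` near_sample u gamma)).
Proof.
have := measurable_fun_xsection (distribution P X) (mfar gamma).
congr (measurable_fun _ _); apply/funext => u /=; congr (distribution P X _).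
by apply/seteqP; split => x; rewrite /xsection/= inE.
Qed.

(** Tonelli lets [x] be fixed first. By independence all [m] sample points then miss its ball with
    probability [(1 - mu (eball x gamma)) ^ m]. *)
Lemma far_mass_le (A : set (d.-tuple R)) (gamma e : R) : measurable A ->
  distribution P X A = 1%E -> 0 <= e <= 1 ->
  (forall x, A x -> (e%:E <= distribution P X (eball x gamma))%E) ->
  (\int[distribution P unlabeled]_u distribution P X (~` near_sample u gamma) <=
    (expR (- (m%:R * e)))%:E)%E.
Proof.
move=> mA A1 /andP[e0 e1] he.
have -> : (\int[distribution P unlabeled]_u distribution P X (~` near_sample u gamma) =
   (distribution P unlabeled \x distribution P X) [set z | (~` near_sample z.1 gamma) z.2])%E.
  apply: eq_integral => u _; congr (distribution P X _).
  by apply/seteqP; split => x; rewrite /xsection/= inE.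
have -> : ((distribution P unlabeled \x distribution P X)
      [set z | (~` near_sample z.1 gamma) z.2] =
    (distribution P unlabeled \x^ distribution P X)
      [set z | (~` near_sample z.1 gamma) z.2])%E.
  by apply: product_measure_unique => // B C mB mC; exact: product_measure2E.
set S := [set z | _]; set c := expR _.
have secE x : ysection S x = tuple_box (fun=> ~` eball x gamma).
  apply/seteqP; split => u; rewrite /ysection/= inE => h.
    by move=> j xj; apply: h; exists j.
  by move=> [j xj]; exact: (h j).
have mball x : measurable (~` eball x gamma).
  by apply: measurableC; exact: measurable_eball.
have fE x : A x -> (distribution P unlabeled (ysection S x) <= c%:E)%E.
  move=> Ax; rewrite secE.
  rewrite -[leLHS]/(P (unlabeled @^-1` tuple_box (fun=> ~` eball x gamma))).
  rewrite unlabeled_box unlabeled_indep//.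
  have mux : distribution P X (~` eball x gamma) =
      (1 - fine (distribution P X (eball x gamma)))%:E.
    have h := probability_setC (distribution P X) (measurable_eball x gamma).
    by rewrite [LHS]h EFinB fineK// fin_num_measure//; exact: measurable_eball.
  rewrite (eq_bigr (fun=> (1 - fine (distribution P X (eball x gamma)))%:E)); last first.
    by move=> j _; rewrite Xu_law; [exact: mux|exact: mball].
  rewrite prodEFin lee_fin prodr_const card_ord.
  have ex : e <= fine (distribution P X (eball x gamma)).
    rewrite -lee_fin fineK; first exact: he.
    by rewrite fin_num_measure//; exact: measurable_eball.
  have x1 : fine (distribution P X (eball x gamma)) <= 1.
    rewrite -lee_fin fineK; last by rewrite fin_num_measure//; exact: measurable_eball.
    by apply: probability_le1; exact: measurable_eball.
  rewrite /c -mulrN expRM_natl lerXn2r ?nnegrE ?subr_ge0 ?expR_ge0//.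
  by apply: le_trans (expR_ge1Dx _); rewrite lerD2l lerN2.
apply: (@le_trans _ _ (\int[distribution P X]_x (cst c%:E x))%E).
  apply: ae_ge0_le_integral => //.
  - by apply: measurable_fun_ysection; exact: mfar.
  - by move=> x _; rewrite lee_fin expR_ge0.
  - exists (~` A); split; first exact: measurableC.
      have h := probability_setC (distribution P X) mA.
      by rewrite [LHS]h [X in (_ - X)%E]A1 subee.
    by move=> x /= h Ax; apply: h => _; exact: fE.
rewrite integral_cst// [X in (_ * X)%E](_ : _ = 1%E) ?mule1//.
exact: probability_setT.
Qed.

End samples.

(** * The expected error as an average over both samples *)

Section expected_regret.
Context {R : realType} {disp : measure_display} {Omega : measurableType disp}.
Variable P : probability Omega R.
Context {d k n m : nat}.
Variables (X : {RV P >-> d.-tuple R}) (Y : {RV P >-> 'I_k.+2}).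
Variables (f : d.-tuple R -> R) (p : 'I_k.+2 -> d.-tuple R -> R).
Variables (kappa gamma0 nu0 : R).
Hypothesis reg : regression X Y p.
Hypothesis dens : strong_density X f kappa gamma0 nu0.
Variables (gamma : R) (Xs : 'I_n -> {RV P >-> d.-tuple R}).
Variables (Ys : 'I_n -> {RV P >-> 'I_k.+2}) (Xu : 'I_m -> {RV P >-> d.-tuple R}).
Variables (net : m.-tuple (d.-tuple R) -> {set 'I_m}).
Variable tau : {set 'I_k.+2} -> 'I_k.+2.
Hypothesis gamma_gt0 : 0 < gamma.
Hypothesis m_gt0 : (0 < m)%N.
Hypothesis samples : optinet_samples X Y Xs Ys Xu.
Hypothesis netP : net_selection gamma net.

Let mu := distribution P X.
Let A0 := regular_points f p.
Let U := unlabeled Xu.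
Let D := labeled Xs Ys.

Let mp j : measurable_fun setT (p j). Proof. by have [] := reg j. Qed.

Let mA0 : measurable A0.
Proof. exact: (measurable_regular_points reg dens). Qed.

Let mnet N : measurable (net @^-1` [set N]). Proof. by have [_] := netP; exact. Qed.

Let mbayes j : measurable (bayes_rule p @^-1` [set j]).
Proof. exact: measurable_bayes_rule. Qed.

Let T := (m.-tuple (d.-tuple R) * n.-tuple (d.-tuple R * 'I_k.+2))%type.

Let opt (z : T) : d.-tuple R -> 'I_k.+2 :=
  optinet z.1 (net z.1) tau (fun i => (tnth z.2 i).1) (fun i => (tnth z.2 i).2).

(** The indicator stands in for a domain of integration, so that Tonelli applies to a function on
    the full product. *)
Let psi (z : T * d.-tuple R) : \bar R :=
  (\1_A0 z.2 * (p (bayes_rule p z.2) z.2 - p (opt z.1 z.2) z.2))%:E.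

Let psi_ge0 z : (0 <= psi z)%E.
Proof. by rewrite lee_fin mulr_ge0// subr_ge0 le_bayes_rule. Qed.

Let mlabeled i : measurable_fun setT (fun z : T * d.-tuple R => tnth z.1.2 i).
Proof.
apply: (measurableT_comp (measurable_tnth i)).
exact: (measurableT_comp measurable_snd measurable_fst).
Qed.

Let mpsi : measurable_fun setT psi.
Proof.
apply/measurable_EFinP; apply: measurable_funM.
  by apply: (@measurableT_comp _ _ _ _ _ _ (\1_A0 : _ -> R)) => //; exact: measurable_indic.
apply: measurable_funB.
  apply: (measurable_fun_finfiber (phi := fun z : T * d.-tuple R => bayes_rule p z.2)
    (F := fun j z => p j z.2)) => j.
    have := @measurable_snd _ _ T (d.-tuple R) measurableT _ (mbayes j).
    by rewrite setTI.
  exact: (measurableT_comp (mp j) measurable_snd).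
apply: (measurable_fun_finfiber (phi := fun z : T * d.-tuple R => opt z.1 z.2)
  (F := fun j z => p j z.2)) => j; last exact: (measurableT_comp (mp j) measurable_snd).
apply: (@measurable_optinet_net _ _ _ _ _ _ _ (fun z : T * d.-tuple R => z.1.1)
  (fun i z => (tnth z.1.2 i).1) (fun i z => (tnth z.1.2 i).2) snd) => //.
- exact: (measurableT_comp measurable_fst measurable_fst).
- by move=> i; apply: (measurableT_comp measurable_fst (mlabeled i)).
- by move=> i; apply: (measurableT_comp measurable_snd (mlabeled i)).
Qed.

Let phi (z : T) := (\int[mu]_x psi (z, x))%E.

Let phiE z : phi z = (\int[mu]_(x in A0) (p (bayes_rule p x) x - p (opt z x) x)%:E)%E.
Proof.
rewrite [RHS]integral_mkcond; apply: eq_integral => x _.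
by rewrite patchE /psi/= indicE; case: ifPn => _; rewrite ?mul1r ?mul0r.
Qed.

Let phi_ge0 z : (0 <= phi z)%E.
Proof. by apply: integral_ge0. Qed.

Let mphi : measurable_fun setT phi.
Proof. exact: measurable_fun_fubini_tonelli_F mpsi psi_ge0. Qed.

Definition net_regret (u : m.-tuple (d.-tuple R)) : \bar R :=
  (\int[mu]_(x in A0) (cell_regret p (cell u (net u)) (bayes_rule p)
    (label_prob Xs Ys tau u (net u)) x)%:E)%E.

Let labeledE w i : tnth (D w) i = (Xs i w, Ys i w).
Proof. exact: tnth_mktuple. Qed.

Let optE u w : opt (u, D w) = optinet u (net u) tau (Xs ^~ w) (Ys ^~ w).
Proof.
have xsE : (fun i => (tnth (D w) i).1) = (Xs ^~ w).
  by apply/funext => i; rewrite labeledE.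
have ysE : (fun i => (tnth (D w) i).2) = (Ys ^~ w).
  by apply/funext => i; rewrite labeledE.
by rewrite -xsE -ysE.
Qed.

Let net_regretE' u : (\int[P]_w phi (u, D w) = net_regret u)%E.
Proof.
have [gn _] := netP.
rewrite /net_regret -(net_regretE reg dens Xs Ys tau gamma_gt0 (gn u) m_gt0).
by apply: eq_integral => w _; rewrite phiE optE.
Qed.

(** The cells and label probabilities vary with [u] through the net. Measurability comes from
    recognising the average of a jointly measurable function over the labeled sample. *)
Lemma measurable_net_regret : measurable_fun setT net_regret.
Proof.
rewrite (_ : net_regret = fun u => \int[distribution P D]_v phi (u, v))%E.
  exact: measurable_fun_fubini_tonelli_F mphi phi_ge0.
apply/funext => u; transitivity (\int[P]_w phi (u, D w))%E.
  by apply/esym; exact: net_regretE'.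
apply/esym; apply: (@ge0_integral_distribution _ _ _ _ _ P D (fun v => phi (u, v))).
  by apply: (measurableT_comp mphi); exact: pair1_measurable.
by move=> v; exact: phi_ge0.
Qed.

Lemma net_regret_ge0 u : (0 <= net_regret u)%E.
Proof. by rewrite -net_regretE'; apply: integral_ge0 => w _; exact: phi_ge0. Qed.

Lemma expected_error :
  ('E_P[fun w => error X Y (optinet (U w) (net (U w)) tau (Xs ^~ w) (Ys ^~ w))] =
   (error X Y (bayes_rule p))%:E + \int[distribution P U]_u net_regret u)%E.
Proof.
rewrite unlock.
have E w : ((error X Y (optinet (U w) (net (U w)) tau (Xs ^~ w) (Ys ^~ w)))%:E =
    (error X Y (bayes_rule p))%:E + phi (U w, D w))%E.
  rewrite (regretE reg dens).
    by rewrite phiE optE.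
  move=> j; apply: (@measurable_optinet _ _ _ _ _ _ _ (cst (U w)) (fun i => cst (Xs i w))
    (fun i => cst (Ys i w)) id) => //.
under eq_integral do rewrite E.
have mphiw : measurable_fun setT (fun w => phi (U w, D w)).
  by apply: (measurableT_comp mphi); exact: measurable_fun_pair.
rewrite (@ge0_integralD _ _ _ P setT measurableT (cst (error X Y (bayes_rule p))%:E)
  (fun w => phi (U w, D w))); last 4 first.
- by move=> w _; rewrite lee_fin; exact: fine_ge0.
- exact: measurable_cst.
- by move=> w _; exact: phi_ge0.
- exact: mphiw.
rewrite integral_cst; last exact: measurableT.
rewrite [X in (_ * X)%E]probability_setT mule1; congr (_ + _)%E.
rewrite (@indep_integral _ _ _ P _ _ _ _ U D phi).
- by apply: eq_integral => u _; exact: net_regretE'.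
- by move=> A B mA mB; exact: (unlabeled_labeled_indep samples).
- exact: mphi.
- exact: phi_ge0.
Qed.

Let phi_le1 z : (phi z <= 1)%E.
Proof.
apply: (@le_trans _ _ (\int[mu]_x (cst 1%E x))%E).
  apply: ge0_le_integral.
  - exact: measurableT.
  - by move=> x _; exact: psi_ge0.
  - by apply: (measurableT_comp mpsi); exact: pair1_measurable.
  - exact: measurable_cst.
  - move=> x _; rewrite /psi/= lee_fin indicE.
    have [/set_mem [pA0 _]|_] := boolP (x \in A0); last by rewrite mul0r.
    by have := pA0 (bayes_rule p x); have := pA0 (opt z x); rewrite mul1r; lra.
rewrite integral_cst; last exact: measurableT.
by rewrite [X in (_ * X)%E]probability_setT mule1.
Qed.

Lemma net_regret_le1 u : (net_regret u <= 1)%E.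
Proof.
rewrite -net_regretE'; apply: (@le_trans _ _ (\int[P]_w (cst 1%E w))%E).
  apply: ge0_le_integral.
  - exact: measurableT.
  - by move=> w _; exact: phi_ge0.
  - apply: (measurableT_comp mphi); apply: measurable_fun_pair => //.
  - exact: measurable_cst.
  - by move=> w _; exact: phi_le1.
rewrite integral_cst; last exact: measurableT.
by rewrite [X in (_ * X)%E]probability_setT mule1.
Qed.

(** The parameters serve three uses: [a = 0] for the trivial bound [1] and for the crude bound,
    [a = 5] for the main one. *)
Lemma expected_net_regret_le (b a e : R) : 0 <= b -> 0 <= a -> 0 <= e <= 1 ->
  (forall x, A0 x -> (e%:E <= mu (eball x gamma))%E) ->
  (forall u, (forall j, A0 (tnth u j)) ->
    (net_regret u <= b%:E + a%:E * mu (~` near_sample u gamma))%E) ->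
  (\int[distribution P U]_u net_regret u <= (b + a * expR (- (m%:R * e)))%:E)%E.
Proof.
move=> b0 a0 e01 he hu.
have mfar : measurable_fun setT
    (fun u : m.-tuple (d.-tuple R) => mu (~` near_sample u gamma)).
  exact: measurable_far_mass.
have A01 : mu A0 = 1%E by exact: (regular_points_full reg dens).
apply: (@le_trans _ _ (\int[distribution P U]_u
    (b%:E + a%:E * mu (~` near_sample u gamma)))%E).
  apply: ae_ge0_le_integral.
  - exact: measurableT.
  - by move=> u _; exact: net_regret_ge0.
  - exact: measurable_net_regret.
  - by move=> u _; rewrite adde_ge0 ?mule_ge0 ?lee_fin.
  - by apply: emeasurable_funD => //; exact: measurable_funeM.
  - exists (~` tuple_box (fun=> A0)); split.
    + apply: measurableC; rewrite tuple_boxE; apply: bigsetI_measurable => j _.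
      by rewrite -[X in measurable X]setTI; exact: measurable_tnth.
    + exact: (unlabeled_almost_in samples mA0 A01).
    + by move=> u /= h uA0; apply: h => _; exact: hu.
rewrite (@ge0_integralD _ _ _ (distribution P U) setT measurableT (cst b%:E)
  (fun u => a%:E * mu (~` near_sample u gamma))%E); last 4 first.
- by move=> u _; rewrite lee_fin.
- exact: measurable_cst.
- by move=> u _; rewrite mule_ge0// lee_fin.
- exact: measurable_funeM.
rewrite integral_cst; last exact: measurableT.
rewrite [X in (_ * X)%E]probability_setT mule1 EFinD; apply: leeD => //.
have -> : (\int[distribution P U]_u (a%:E * mu (~` near_sample u gamma)) =
    a%:E * \int[distribution P U]_u mu (~` near_sample u gamma))%E.
  by apply: ge0_integralZl => //; rewrite lee_fin.
rewrite EFinM; apply: lee_wpmul2l; first by rewrite lee_fin.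
exact: (far_mass_le samples mA0 A01).
Qed.

End expected_regret.

(** * Choice of the constants *)

(** Here [q] is [n gamma ^ d], [K] is [m gamma ^ d], [g] is [gamma] and [r] is the excess error. The
    constants are fixed before these four, which is the uniformity claimed in the theorem. *)
Lemma rate_bound {R : realType} (M b0 a3 e1 alpha beta C c' K0 : R) :
  1 <= M -> 0 < b0 -> 0 < a3 -> 0 < e1 -> 0 < alpha -> 0 < beta -> 0 < C -> 0 < c' -> 0 < K0 ->
  exists C1 C2 c : R, [/\ 0 < C1, 0 < C2, 0 < c & forall q g K r : R,
    0 < q -> 0 < g -> 0 <= K -> r <= 1 ->
    r <= 1 - (2 * M)^-1 + M * expR (- (b0 * q / (32 * M ^+ 2))) ->
    r <= c' * (4 * (C * (4 * g) `^ beta)) `^ (1 + alpha) +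
         M * K0 * c' * (a3 / (b0 * q)) `^ ((1 + alpha) / 2) +
         5 * expR (- (e1 * K)) ->
    r <= C1 * q `^ (- ((1 + alpha) / 2)) + C2 * g `^ (beta * (1 + alpha)) +
         expR (- (c * K))].
Proof.
move=> M1 b00 a30 e10 alpha0 beta0 C0 c'0 K00.
have M0 : 0 < M by apply: lt_le_trans M1.
set h := (1 + alpha) / 2.
have h0 : 0 <= h by rewrite /h; lra.
(* For [q] above [T] the crude exponent is at least [4 M ^ 2], so that its exponential times [M] is
   at most [1 / (4 M)]. *)
pose T := 128 * M ^+ 4 / b0.
have T0 : 0 < T by rewrite divr_gt0// mulr_gt0// exprn_gt0.
have r8 : 0 < a3 / b0 by rewrite divr_gt0.
have CC0 : 0 < 4 * (C * 4 `^ beta) by rewrite !mulr_gt0// powR_gt0.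
have A0 : 0 < M * K0 * c' * (a3 / b0) `^ h by rewrite !mulr_gt0// powR_gt0.
(* The summand with [T] makes the first term at least [1] when [q <= T]. The rate [e1 / (32 M)]
   makes the last exponential at least [1 - 1 / (4 M)] as long as [e1 K < 8]. *)
exists (M * K0 * c' * (a3 / b0) `^ h + T `^ h),
  (c' * (4 * (C * 4 `^ beta)) `^ (1 + alpha)), (e1 / (32 * M)); split.
- by rewrite addr_gt0// powR_gt0.
- by rewrite mulr_gt0// powR_gt0.
- by rewrite divr_gt0// mulr_gt0.
move=> q g K r q0 g0 K0' r1 crude main; rewrite mulrDl.
have qh0 : 0 < q `^ (- h) by rewrite powR_gt0.
have gE : c' * (4 * (C * (4 * g) `^ beta)) `^ (1 + alpha) =
    c' * (4 * (C * 4 `^ beta)) `^ (1 + alpha) * g `^ (beta * (1 + alpha)).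
  have -> : 4 * (C * (4 * g) `^ beta) = 4 * (C * 4 `^ beta) * g `^ beta.
    by rewrite powRM ?(ltW g0)// !mulrA.
  by rewrite powRM ?powR_ge0 ?(ltW CC0)// mulrA -powRrM.
have qE : M * K0 * c' * (a3 / (b0 * q)) `^ h =
    M * K0 * c' * (a3 / b0) `^ h * q `^ (- h).
  have -> : a3 / (b0 * q) = a3 / b0 * q^-1 by rewrite invfM mulrA.
  rewrite powRM ?(ltW r8) ?invr_ge0 ?(ltW q0)// mulrA; congr (_ * _).
  by rewrite powRN -powR_inv1 ?(ltW q0)// powRAC powR_inv1 ?powR_ge0.
have G0 : 0 < c' * (4 * (C * 4 `^ beta)) `^ (1 + alpha) * g `^ (beta * (1 + alpha)).
  by rewrite !mulr_gt0// powR_gt0.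
have Q0 : 0 < M * K0 * c' * (a3 / b0) `^ h * q `^ (- h) by rewrite mulr_gt0.
have Th0 : 0 < T `^ h * q `^ (- h) by rewrite mulr_gt0// powR_gt0.
rewrite gE qE in main; move: G0 Q0 Th0 main; clear gE qE.
set G := c' * _ `^ _ * _; set Q := _ * q `^ _; set W := _ * q `^ _.
move=> G0 Q0 Th0 main.
have E0 := expR_gt0 (- (e1 / (32 * M) * K)).
(* From [8] on, [expR (e1 K / 2) >= 1 + 4], so half of the exponent pays for the factor [5]. *)
have [KT|KT] := leP 8 (e1 * K).
  apply: (le_trans main).
  suff : 5 * expR (- (e1 * K)) <= expR (- (e1 / (32 * M) * K)) by lra.
  apply: (@le_trans _ _ (expR (- (e1 * K / 2)))).
    rewrite (_ : - (e1 * K) = - (e1 * K / 2) - e1 * K / 2); last by lra.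
    rewrite expRD mulrCA ler_piMr ?expR_ge0// expRN ler_pdivrMr ?expR_gt0// mul1r.
    by apply: le_trans (expR_ge1Dx _); lra.
  rewrite ler_expR lerN2 (_ : e1 / (32 * M) * K = e1 * K / (32 * M)); last by lra.
  rewrite ler_wpM2l//; first by lra.
  by rewrite lef_pV2 ?posrE ?mulr_gt0//; lra.
have [qT|qT] := leP q T.
  suff : 1 <= W by lra.
  rewrite /W powRN ler_pdivlMr ?powR_gt0// mul1r.
  by rewrite ge0_ler_powR// nnegrE ltW.
set y := b0 * q / (32 * M ^+ 2) in crude.
have yM : 4 * M ^+ 2 <= y.
  rewrite /y ler_pdivlMr ?mulr_gt0 ?exprn_gt0//.
  move: qT; rewrite /T ltr_pdivrMr// => /ltW qT.
  have E : 4 * M ^+ 2 * (32 * M ^+ 2) = 128 * M ^+ 4 by ring.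
  by rewrite E (mulrC b0).
have M20 : 0 < 4 * M ^+ 2 by apply: mulr_gt0 => //; exact: exprn_gt0.
have y0 : 0 < y by apply: lt_le_trans yM.
have ey : M * expR (- y) <= (4 * M)^-1.
  apply: (@le_trans _ _ (M * (4 * M ^+ 2)^-1)).
    rewrite ler_wpM2l ?(ltW M0)// expRN lef_pV2 ?posrE ?expR_gt0//.
    by apply: (le_trans yM); apply: le_trans (expR_ge1Dx _); lra.
  by rewrite le_eqVlt; apply/orP; left; apply/eqP; field; rewrite gt_eqF.
have : 1 - (4 * M)^-1 <= expR (- (e1 / (32 * M) * K)).
  apply: le_trans (expR_ge1Dx _); rewrite lerD2l lerN2.
  rewrite (_ : (4 * M)^-1 = 8 / (32 * M)); last by field; rewrite gt_eqF.
  rewrite mulrAC; apply: ler_wpM2r; last exact: ltW.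
  by rewrite invr_ge0; apply: mulr_ge0 => //; exact: ltW.
have E2 : (2 * M)^-1 = (4 * M)^-1 + (4 * M)^-1 by field; rewrite gt_eqF.
by move: crude; rewrite E2; lra.
Qed.

(* The number M >= 2 of classes is k.+2. *)
Theorem theorem1 (R : realType) (d k : nat)
    (kappa gamma0 nu0 alpha cstar C beta : R) :
  0 < kappa -> 0 < gamma0 -> 0 < nu0 -> 0 < alpha -> 0 < cstar ->
  0 < C -> 0 < beta <= 1 ->
  exists C1 C2 c : R, [/\ 0 < C1, 0 < C2, 0 < c &
    forall (disp : measure_display) (Omega : measurableType disp)
      (P : probability Omega R)
      (X : {RV P >-> d.-tuple R}) (Y : {RV P >-> 'I_k.+2})
      (f : d.-tuple R -> R) (p : 'I_k.+2 -> d.-tuple R -> R),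
    regression X Y p ->
    strong_density X f kappa gamma0 nu0 ->
    tsybakov_margin X p alpha cstar ->
    hoelder_condition p C beta ->
    forall (n m : nat) (gamma : R),
    (0 < n)%N -> (0 < m)%N -> 0 < gamma <= gamma0 ->
    forall (Xs : 'I_n -> {RV P >-> d.-tuple R})
      (Ys : 'I_n -> {RV P >-> 'I_k.+2})
      (Xu : 'I_m -> {RV P >-> d.-tuple R})
      (net : m.-tuple (d.-tuple R) -> {set 'I_m})
      (tau : {set 'I_k.+2} -> 'I_k.+2),
    optinet_samples X Y Xs Ys Xu ->
    net_selection gamma net ->
    tie_breaking tau ->
    let g (w : Omega) : d.-tuple R -> 'I_k.+2 :=
      let xu := [tuple Xu j w | j < m] in
      optinet xu (net xu) tau (fun i => Xs i w) (fun i => Ys i w) in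
    ('E_P[fun w => error X Y (g w)] - (error X Y (bayes_rule p))%:E <=
     (C1 * (n%:R * gamma ^+ d) `^ (- ((1 + alpha) / 2))
      + C2 * gamma `^ (beta * (1 + alpha))
      + expR (- (c * m%:R * gamma ^+ d)))%:E)%E].
Proof.
move=> kappa0 gamma00 nu00 alpha0 cstar0 C0 /andP[beta0 _].
have [K0 K00 margin] := margin_integral alpha0.
pose b0 := kappa * nu0 / 2 ^+ d.
have e10 : 0 < kappa * nu0 by rewrite mulr_gt0.
have b00 : 0 < b0 by rewrite divr_gt0// exprn_gt0.
(* The margin condition stops at [t = 1]. With a constant at least [1] it extends to every [t > 0],
   as required by [margin_integral] and by the threshold [4 * cell_osc], which may exceed [1]. *)
pose c' := Num.max cstar 1.
have c'0 : 0 < c' by rewrite lt_max cstar0.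
have M1 : 1 <= k.+2%:R :> R by rewrite ler1n.
have [C1 [C2 [c [C10 C20 c0 rate]]]] :=
  rate_bound M1 b00 (exprn_gt0 3 (ltr0n R 8)) e10 alpha0 beta0 C0 c'0 K00.
exists C1, C2, c; split=> // disp Omega P X Y f p reg dens tsy hoel n m gamma.
move=> n0 m0 /andP[gamma_gt0 gamma_le] Xs Ys Xu net tau samples netP tauP.
set A0 := regular_points f p.
set mu := distribution P X.
have gd0 : 0 < gamma ^+ d by rewrite exprn_gt0.
have mp j : measurable_fun setT (p j) by have [] := reg j.
have ball x : A0 x -> ((kappa * nu0 * gamma ^+ d)%:E <= mu (eball x gamma))%E.
  by move=> A0x; apply: (regular_ball kappa0 gamma00 dens A0x); rewrite gamma_gt0.
(* Regular points have full mass, so one exists, and the probability of its ball bounds this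
   quantity by [1]. *)
have e01 : 0 <= kappa * nu0 * gamma ^+ d <= 1.
  rewrite mulr_ge0 ?(ltW e10) ?(ltW gd0)//=.
  have [x A0x] : A0 !=set0.
    apply/set0P/eqP => A00; have := regular_points_full reg dens.
    by rewrite -/A0 A00 measure0 => /eqP; rewrite eq_sym onee_eq0.
  rewrite -lee_fin; apply: le_trans (ball x A0x) _.
  by apply: probability_le1; exact: measurable_eball.
have marginP t : 0 < t -> (mu [set x | (eta p x <= t)%R] <= (c' * t `^ alpha)%:E)%E.
  move=> t0; have [t1|t1] := leP t 1.
    apply: (le_trans (tsy t _)); first by rewrite t0.
    by rewrite lee_fin ler_wpM2r ?powR_ge0// le_max lexx.
  apply: (@le_trans _ _ 1%E).
    apply: probability_le1; apply: measurable_set_pred.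
    by apply: measurable_fun_ler => //; exact: measurable_eta.
  rewrite lee_fin mulr_ege1//; first by rewrite le_max lexx orbT.
  apply: (@le_trans _ _ (1 `^ alpha)); first by rewrite powR1.
  by apply: ge0_ler_powR; rewrite ?nnegrE ?(ltW alpha0) ?(ltW t0) ?(ltW t1).
have [Zlaw _ _] := samples.
have Zindep := labeled_indep samples.
set q := n%:R * gamma ^+ d.
have q0 : 0 < q by rewrite mulr_gt0// ltr0n.
have massE : n%:R * @cell_mass_bound R d kappa nu0 gamma = b0 * q.
  rewrite /cell_mass_bound /b0 /q expr_div_n; field.
  by rewrite expf_neq0.
pose I := (\int[distribution P (unlabeled Xu)]_u
  net_regret X f p Xs Ys net tau u)%E.
have I0 : (0 <= I)%E.
  apply: integral_ge0 => u _.
  exact: (net_regret_ge0 reg dens Xs Ys tau gamma_gt0 m0 netP).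
have Ile1 : (I <= 1)%E.
  have := @expected_net_regret_le _ _ _ _ _ _ _ _ _ _ _ _ _ _ _ reg dens
    gamma Xs Ys Xu net tau gamma_gt0 m0 samples netP 1 0 _ ler01 (lexx 0) e01 ball.
  rewrite mul0r addr0; apply => u _; rewrite mul0e adde0.
  exact: (net_regret_le1 reg dens Xs Ys tau gamma_gt0 m0 netP).
have Ifin : I \is a fin_num by rewrite ge0_fin_numE// (le_lt_trans Ile1) ?ltry.
pose r := fine I.
have IE : I = r%:E by rewrite fineK.
have gap_gt0 : 0 < 4 * (C * (4 * gamma) `^ beta).
  by rewrite !mulr_gt0// powR_gt0// mulr_gt0.
have r1 : r <= 1 by rewrite -lee_fin -IE.
have crude : r <= 1 - (2 * k.+2%:R)^-1 +
    k.+2%:R * expR (- (b0 * q / (32 * k.+2%:R ^+ 2))).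
  rewrite -lee_fin -IE; set B := _ + _.
  have B0 : 0 <= B.
    rewrite addr_ge0 ?mulr_ge0 ?expR_ge0// subr_ge0 invf_le1 ?mulr_gt0//; lra.
  have := @expected_net_regret_le _ _ _ _ _ _ _ _ _ _ _ _ _ _ _ reg dens
    gamma Xs Ys Xu net tau gamma_gt0 m0 samples netP B 0 _ B0 (lexx 0) e01 ball.
  rewrite mul0r addr0; apply => u ureg; rewrite mul0e adde0 /B -massE.
  have [gn _] := netP.
  exact: (net_regret_crude kappa0 gamma00 nu00 reg dens tauP Zlaw Zindep
    gamma_gt0 gamma_le (gn u) ureg).
have main : r <= c' * (4 * (C * (4 * gamma) `^ beta)) `^ (1 + alpha) +
    k.+2%:R * K0 * c' * (8 ^+ 3 / (b0 * q)) `^ ((1 + alpha) / 2) +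
    5 * expR (- (kappa * nu0 * (m%:R * gamma ^+ d))).
  (* This solves the normalisation required by [net_regret_main], since [n] times the cell mass
     bound is [b0 * q]. *)
  pose s := (8 ^+ 3 / (b0 * q)) `^ 2^-1.
  have bq0 : 0 < 8 ^+ 3 / (b0 * q) by apply: divr_gt0; [exact: exprn_gt0|exact: mulr_gt0].
  have s0 : 0 < s by rewrite powR_gt0.
  have sE : n%:R * @cell_mass_bound R d kappa nu0 gamma * s ^+ 2 = 8 ^+ 3.
    rewrite massE -powR_mulrn ?powR_ge0// -powRrM mulVf// powRr1 ?(ltW bq0)//.
    by rewrite mulrC divfK// gt_eqF// mulr_gt0.
  have -> : k.+2%:R * K0 * c' * (8 ^+ 3 / (b0 * q)) `^ ((1 + alpha) / 2) =
      k.+2%:R * s * (K0 * c' * s `^ alpha).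
    have <- : s * s `^ alpha = (8 ^+ 3 / (b0 * q)) `^ ((1 + alpha) / 2).
      rewrite -[X in X * _]powRr1 ?(ltW s0)// -powRD; last first.
        by apply/implyP => _; rewrite gt_eqF.
      by rewrite /s -powRrM [2^-1 * _]mulrC.
    by ring.
  set G := 4 * _; set B := c' * G `^ _ + _ * (_ * s `^ _).
  have B0 : 0 <= B.
    by rewrite /B addr_ge0// !mulr_ge0 ?powR_ge0 ?(ltW c'0) ?(ltW K00) ?(ltW s0).
  rewrite -lee_fin -IE.
  have := @expected_net_regret_le _ _ _ _ _ _ _ _ _ _ _ _ _ _ _ reg dens
    gamma Xs Ys Xu net tau gamma_gt0 m0 samples netP B 5 _ B0 (ler0n _ 5) e01 ball.
  rewrite [in X in (_ -> X) -> _](mulrCA m%:R); apply => u ureg.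
  have [gn _] := netP.
  apply: (le_trans (net_regret_main kappa0 gamma00 nu00 C0 beta0 reg dens hoel
    tauP Zlaw Zindep gamma_gt0 gamma_le (gn u) ureg s0 sE)).
  have mfar : measurable (~` near_sample u gamma).
    by apply: measurableC; exact: measurable_near_sample.
  rewrite [(5 * _)%:E]EFinM fineK ?fin_num_measure// addeAC leeD2r// /B EFinD.
  rewrite /cell_osc -/G; apply: leeD.
    apply: (@le_trans _ _ (G%:E * (c' * G `^ alpha)%:E)%E).
      by apply: lee_wpmul2l; [rewrite lee_fin ltW|exact: marginP].
    rewrite -EFinM lee_fin mulrCA powRD ?powRr1 ?(ltW gap_gt0)//.
    by apply/implyP => _; rewrite gt_eqF.
  rewrite [leRHS]EFinM; apply: lee_wpmul2l; first by rewrite lee_fin mulr_ge0// ltW.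
  apply: margin => //; [exact: measurable_eta|exact: ltW].
have := rate q gamma (m%:R * gamma ^+ d) r q0 gamma_gt0 _ r1 crude main.
rewrite mulrA => rate_r.
have errE := expected_error reg dens tau gamma_gt0 m0 samples netP.
rewrite -/I IE in errE.
suff : ((error X Y (bayes_rule p))%:E + r%:E - (error X Y (bayes_rule p))%:E <=
    (C1 * q `^ (- ((1 + alpha) / 2)) + C2 * gamma `^ (beta * (1 + alpha)) +
     expR (- (c * m%:R * gamma ^+ d)))%:E)%E by rewrite -errE.
rewrite addeAC subee// add0e lee_fin; apply: rate_r.
by rewrite mulr_ge0// ltW.
Qed.
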